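(* Let $\mathcal{H}$ be a complex Hilbert space with orthonormal basis $\{e_i\}_{i=0}^\infty$, let $\alpha=\{\alpha_i\}_{i=0}^\infty$ be a convergent sequence of complex numbers, and let $S_\alpha$ be the weighted shift operator on $\mathcal{H}$ with weight $\alpha$, i.e. $S_\alpha e_i=\alpha_i e_{i+1}$ for $i\ge 0$. Then the following statements are equivalent. (1) The weight $\alpha$ is regular, i.e. $\lim_{i\to\infty}|\alpha_i|\ge|\alpha_m|$ for every $m\in\mathbb{N}$. (2) For every $n\ge 2$, every $(l_1,\dots,l_n)\in\mathbb{N}^n$ and every $0\le k\le n$, $$\|S_{\alpha}^{l_1}\odot\cdots\odot S_{\alpha}^{l_k}\odot S_{\alpha}^{*l_{k+1}}\odot\cdots\odot S_{\alpha}^{*l_n}\|=\prod_{i=1}^n\|S_\alpha^{l_i}\|.$$ (3) For every $n\ge 2$, every $(l_1,\dots,l_n)\in\mathbb{N}^n$ and every $0\le k\le n$, $$\|S_{\alpha}^{l_1}\wedge\cdots\wedge S_{\alpha}^{l_k}\wedge S_{\alpha}^{*l_{k+1}}\wedge\cdots\wedge S_{\alpha}^{*l_n}\|=\prod_{i=1}^n\|S_\alpha^{l_i}\|.$$ Moreover, in this case, setting $\lambda=\lim_{i\to\infty}|\alpha_i|$, one has for all such $n$, $k$ and $(l_1,\dots,l_n)$ $$\|S_{\alpha}^{l_1}\odot\cdots\odot S_{\alpha}^{l_k}\odot S_{\alpha}^{*l_{k+1}}\odot\cdots\odot S_{\alpha}^{*l_n}\|=\|S_{\alpha}^{l_1}\wedge\cdots\wedge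 S_{\alpha}^{l_k}\wedge S_{\alpha}^{*l_{k+1}}\wedge\cdots\wedge S_{\alpha}^{*l_n}\|=\lambda^{l_1+l_2+\cdots+l_n}.$$
   Context: $\mathbb{N}=\{0,1,2,\dots\}$. $S_\alpha^*$ is the adjoint of $S_\alpha$, $S_\alpha^{*l}=(S_\alpha^* )^l$, and zeroth powers are the identity operator (and $\lambda^0=1$). $\mathcal{H}^{\otimes n}$ is the Hilbert space tensor power of $\mathcal{H}$; $\mathcal{H}^{\odot n}$ and $\mathcal{H}^{\wedge n}$ are its closed subspaces of symmetric and antisymmetric tensors. $\Sigma_n$ is the group of permutations of $\{1,\dots,n\}$. For bounded operators $A_1,\dots,A_n$ on $\mathcal{H}$, $A_1\otimes\cdots\otimes A_n$ is the bounded operator on $\mathcal{H}^{\otimes n}$ with $(A_1\otimes\cdots\otimes A_n)(v_1\otimes\cdots\otimes v_n)=A_1v_1\otimes\cdots\otimes A_nv_n$, and $$\mathrm{S}_n(A_1,\dots,A_n)=\frac1{n!}\sum_{\pi\in\Sigma_n}A_{\pi(1)}\otimes\cdots\otimes A_{\pi(n)}.$$ This operator leaves $\mathcal{H}^{\odot n}$ and $\mathcal{H}^{\wedge n}$ invariant, and one defines $A_1\odot\cdots\odot A_n=\mathrm{S}_n(A_1,\dots,A_n)|_{\mathcal{H}^{\odot n}}$ and $A_1\wedge\cdots\wedge A_n=\mathrm{S}_n(A_1,\dots,A_n)|_{\mathcal{H}^{\wedge n}}$. Norms are operator norms on these spaces. *)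

(* Defs.v *)
From HB Require Import structures.
From mathcomp Require Import all_boot all_order all_algebra all_fingroup.
From mathcomp Require Import complex.
From mathcomp Require Import all_classical all_reals all_analysis.

Set Implicit Arguments.
Unset Strict Implicit.
Unset Printing Implicit Defensive.

Import Order.TTheory GRing.Theory Num.Theory.
Import numFieldNormedType.Exports.

Local Open Scope classical_set_scope.
Local Open Scope complex_scope.
Local Open Scope ring_scope.

(* The inner product is linear in its first argument. *)
HB.mixin Record NormedModule_isHilbert (R : realType) H
    & CompleteNormedModule R[i] H := {
  inner : {dot H for Num.conj};
  innerE : forall x : H, inner x x = `|x| ^+ 2 }.

#[short(type="hilbertType")]
HB.structure Definition Hilbert (R : realType) :=
  {H of NormedModule_isHilbert R H & CompleteNormedModule R[i] H}.

(* Norms over R[i] take values in R[i]; this is the same number in R. *)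
Definition rnorm (R : realType) (V : normedZmodType R[i]) (x : V) : R :=
  complex.Re `|x|.
Arguments rnorm {R V} x.

Section Spaces.
Context {R : realType}.

Definition lspan (V : lmodType R[i]) (D : set V) : set V :=
  [set x | exists m (c : 'I_m -> R[i]) (v : 'I_m -> V),
    (forall j, D (v j)) /\ x = \sum_(j < m) c j *: v j].

Definition bounded_op (V : hilbertType R) (A : V -> V) : Prop :=
  linear A /\ continuous A.

Definition opnorm_on (V : hilbertType R) (D : set V) (A : V -> V) : R :=
  sup [set rnorm (A x) | x in [set x | D x /\ rnorm x <= 1]].

Definition opnorm (V : hilbertType R) (A : V -> V) : R := opnorm_on setT A.

(* By Riesz, exactly one such B exists when A is bounded. *)
Definition adjoint (V : hilbertType R) (A : V -> V) : V -> V :=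
  get [set B | bounded_op B /\ forall x y, inner (A x) y = inner x (B y)].

Definition orthonormal_basis (V : hilbertType R) (e : nat -> V) : Prop :=
  (forall i j, inner (e i) (e j) = (i == j)%:R) /\
  closure (lspan (range e)) = setT.

Definition weighted_shift (V : hilbertType R) (e : nat -> V)
    (alpha : nat -> R[i]) (S : V -> V) : Prop :=
  bounded_op S /\ forall i, S (e i) = alpha i *: e i.+1.

Definition regular_weight (alpha : nat -> R[i]) : Prop :=
  forall m, rnorm (alpha m) <= limn (fun i => rnorm (alpha i)).

End Spaces.

Section TensorPower.
Context {R : realType} {H T : hilbertType R} {n : nat}.
Variable tens : ('I_n -> H) -> T.

Definition multilinear : Prop :=
  forall (v : 'I_n -> H) (i : 'I_n) (a : R[i]) (x y : H),
    tens [eta v with i |-> a *: x + y] =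
    a *: tens [eta v with i |-> x] + tens [eta v with i |-> y].

(* These properties determine T, with its map (v_1, ..., v_n) |->            *)
(* v_1 (x) ... (x) v_n, up to a unique isometric isomorphism.                *)
Definition tensor_power : Prop :=
  [/\ multilinear,
      forall v w, inner (tens v) (tens w) = \prod_(i < n) inner (v i) (w i)
    & closure (lspan (range tens)) = setT].

(* When the range of tens is total, at most one bounded operator maps each   *)
(* tens v to tens (f v). One exists whenever f composes v with bounded       *)
(* operators or with a permutation; otherwise the value is a junk default.   *)
Definition tens_extend (f : ('I_n -> H) -> ('I_n -> H)) : T -> T :=
  get [set B | bounded_op B /\ forall v, B (tens v) = tens (f v)].

Definition tens_op (A : 'I_n -> H -> H) : T -> T :=
  tens_extend (fun v i => A i (v i)).

Definition perm_op (s : 'S_n) : T -> T := tens_extend (fun v => v \o s).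

(* perm_op s sends v_1 (x) ... (x) v_n to v_s(1) (x) ... (x) v_s(n); its      *)
(* inverse has s^-1 for s, so that convention does not affect the subspaces. *)
Definition sym_tensors : set T := [set x | forall s : 'S_n, perm_op s x = x].

Definition antisym_tensors : set T :=
  [set x | forall s : 'S_n, perm_op s x = (-1) ^+ s *: x].

Definition Sop (A : 'I_n -> H -> H) (x : T) : T :=
  (n`!%:R)^-1 *: \sum_(s : 'S_n) tens_op (A \o s) x.

Definition sym_norm (A : 'I_n -> H -> H) : R := opnorm_on sym_tensors (Sop A).

Definition antisym_norm (A : 'I_n -> H -> H) : R :=
  opnorm_on antisym_tensors (Sop A).

End TensorPower.

(* S^(l_1), ..., S^(l_k), S^*(l_(k+1)), ..., S^*(l_n); indices start at 0.   *)
Definition shift_powers {R : realType} {H : hilbertType R} (S : H -> H)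
    n (k : nat) (l : 'I_n -> nat) : 'I_n -> H -> H :=
  fun i => if (i < k)%N then iter (l i) S else iter (l i) (adjoint S).

(* Main.v *)
Require Import Defs.
From mathcomp Require Import all_boot all_order all_algebra all_fingroup.
From mathcomp Require Import complex.
From mathcomp Require Import all_classical all_reals all_analysis.
From mathcomp Require Import ring lra.
Set Implicit Arguments.
Unset Strict Implicit.
Unset Printing Implicit Defensive.

Import Order.TTheory GRing.Theory Num.Theory.
Import numFieldNormedType.Exports.
Local Open Scope classical_set_scope.
Local Open Scope complex_scope.
Local Open Scope ring_scope.

(** Let [a] be the limit of the weight.

    Regular weight. The shift and its adjoint have norm at most [|a|], and a
    tensor product of operators is bounded by the product of the norms, so every
    norm in question is at most [|a|] to the power [l_1 + ... + l_n]
    ([Sop_le]). Conversely, normalised sums over long blocks of basis vectors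
    far out are approximate eigenvectors of the shift for the value [a]
    ([approx_eigenvectors]). Take [n] disjoint blocks and form the signed or
    unsigned sum [x] of the permutations of their tensor product: [x] is
    antisymmetric or symmetric, [|x| ^+ 2 = n!], and [<Sop x, x>] tends to [n!]
    times a product of powers of [a] and of its conjugate ([Sop_lower]). So the
    bound is reached in the limit on both subspaces, and similarly for the
    powers of the shift itself.

    Weight that is not regular. Some weight exceeds [|a|], so the norm [M] of
    the shift exceeds all weights from some index on by a fixed amount. For
    two factors and the exponents (1, 0) the operator is [(A + B) / 2], where
    [A] and [B] are the shift on the first and on the second factor. If its norm
    were [M], there would be vectors [x] of norm at most one with [|A x|] close
    to [M] and [A x] close to [B x]. The first property pushes the mass of [x],
    in the first index, below some fixed [K]. The operator [B] does not touch the
    first index while [A] raises it by one; so if [x] has almost no mass at first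
    index [k + 1] and beyond, neither has [B x], nor [A x], and [x] has almost no
    mass at first index [k] and beyond. Descending to [k = 0] is absurd
    ([shift_sum_gap]). Thus the equality of norms fails, on symmetric and on
    antisymmetric tensors alike.

    The tensor power enters only through the inner products of elementary
    tensors and their totality. Operators are built by extension from a total
    family ([total_extend]), and inequalities between quadratic forms are
    carried from [H] to one factor of the tensor power by the Schur product
    theorem ([psd_gram], [slot_forms]); on [H] itself the forms that occur are
    diagonal in the basis ([diagonal_forms]). *)

(** * Norms, limits and bounded operators in terms of real numbers *)

Section Norm.
Context {R : realType} {V : normedModType R[i]}.
Implicit Types (x y : V) (c : R[i]).

Lemma rnormE (W : normedZmodType R[i]) (x : W) : `|x| = (rnorm x)%:C.
Proof. by rewrite /rnorm RRe_real // normr_real. Qed.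

Lemma rnorm_ge0 (W : normedZmodType R[i]) (x : W) : 0 <= rnorm x.
Proof. by rewrite -ler0c -rnormE normr_ge0. Qed.

Lemma rnorm_eq0 (W : normedZmodType R[i]) (x : W) : rnorm x = 0 -> x = 0.
Proof. by move=> h; apply/eqP; rewrite -normr_eq0 rnormE h. Qed.

Lemma rnorm0 (W : normedZmodType R[i]) : rnorm (0 : W) = 0.
Proof. by rewrite /rnorm normr0. Qed.

Lemma rnormN (W : normedZmodType R[i]) (x : W) : rnorm (- x) = rnorm x.
Proof. by rewrite /rnorm normrN. Qed.

Lemma rdistC (W : normedZmodType R[i]) (x y : W) :
  rnorm (x - y) = rnorm (y - x).
Proof. by rewrite -rnormN opprB. Qed.

Lemma rnormD (W : normedZmodType R[i]) (x y : W) :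
  rnorm (x + y) <= rnorm x + rnorm y.
Proof. by rewrite -lecR rmorphD /= -!rnormE ler_normD. Qed.

Lemma rnormZ c x : rnorm (c *: x) = rnorm c * rnorm x.
Proof. by apply: complexI; rewrite rmorphM /= -!rnormE normrZ. Qed.

Lemma rnormM c d : rnorm (c * d) = rnorm c * rnorm d.
Proof. by apply: complexI; rewrite rmorphM /= -!rnormE normrM. Qed.

Lemma rnormX c k : rnorm (c ^+ k) = rnorm c ^+ k.
Proof. by apply: complexI; rewrite rmorphXn /= -!rnormE normrX. Qed.

Lemma rnorm_prod (I : Type) (s : seq I) (P : pred I) (F : I -> R[i]) :
  rnorm (\prod_(i <- s | P i) F i) = \prod_(i <- s | P i) rnorm (F i).
Proof.
apply: complexI; rewrite rmorph_prod /= -!rnormE normr_prod.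
by apply: eq_bigr => i _; rewrite rnormE.
Qed.

Lemma rnorm_real (a : R) : rnorm a%:C = `|a|.
Proof.
by apply: complexI; rewrite -rnormE normc_def /= expr0n /= addr0 sqrtr_sqr.
Qed.

Lemma rnorm_sum (W : normedZmodType R[i]) (I : Type) (s : seq I) (P : pred I)
    (F : I -> W) :
  rnorm (\sum_(i <- s | P i) F i) <= \sum_(i <- s | P i) rnorm (F i).
Proof.
elim/big_ind2 : _ => [|a x b y ha hb|//]; first by rewrite rnorm0.
exact: (le_trans (rnormD _ _) (lerD ha hb)).
Qed.

Lemma rnorm_conj c : rnorm c^*%R = rnorm c.
Proof. by apply: complexI; rewrite -!rnormE norm_conjC. Qed.

Lemma conjC_real (a : R) : (a%:C)^*%R = a%:C :> R[i].
Proof. exact: conjc_real. Qed.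

Lemma Re_le_rnorm c : `|complex.Re c| <= rnorm c.
Proof.
case: c => a b; rewrite /rnorm normc_def /= -sqrtr_sqr.
by rewrite ler_wsqrtr // lerDl sqr_ge0.
Qed.

Lemma ReD (a b : R[i]) : complex.Re (a + b) = complex.Re a + complex.Re b.
Proof. by case: a b => ? ? []. Qed.

Lemma ReB (a b : R[i]) : complex.Re (a - b) = complex.Re a - complex.Re b.
Proof. by case: a b => ? ? []. Qed.

Lemma Re_conjC (a : R[i]) : complex.Re a^*%R = complex.Re a.
Proof. by case: a. Qed.

Lemma nbhs_rnorm x (A : set V) :
  nbhs x A <-> exists2 r : R, 0 < r & forall y, rnorm (x - y) < r -> A y.
Proof.
split=> [/nbhs_ballP[r /= r0 h]|[r r0 h]].
- have rE : r = (complex.Re r)%:C by rewrite RRe_real // gtr0_real.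
  exists (complex.Re r); first by rewrite -ltcR -rE.
  by move=> y xy; apply: h; rewrite -ball_normE /= rnormE rE ltcR.
- apply/nbhs_ballP; exists r%:C; first by rewrite /= ltcR.
  by move=> y; rewrite -ball_normE /= rnormE ltcR; exact: h.
Qed.

Lemma closure_rnorm (D : set V) x :
  closure D x <-> forall r : R, 0 < r -> exists2 y, D y & rnorm (x - y) < r.
Proof.
split=> [h r r0|h B /nbhs_rnorm[r r0 hB]].
- have [|y [Dy xy]] := h [set y | rnorm (x - y) < r]; last by exists y.
  by apply/nbhs_rnorm; exists r.
- by have [y Dy xy] := h _ r0; exists y; split=> //; exact: hB.
Qed.

Lemma cvg_rnorm (u : nat -> V) x :
  (u @ \oo --> x) <->
  forall r : R, 0 < r -> exists N, forall k, (N <= k)%N -> rnorm (x - u k) < r.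
Proof.
split=> [h r r0|h B /nbhs_rnorm[r r0 hB]].
- have : nbhs x [set y | rnorm (x - y) < r] by apply/nbhs_rnorm; exists r.
  by move=> /h[N _ hN]; exists N => k; exact: hN.
- by have [N hN] := h _ r0; exists N => // k /hN; exact: hB.
Qed.

End Norm.

Lemma cauchy_rnorm (R : realType) (V : completeNormedModType R[i])
    (u : nat -> V) :
  (forall r : R, 0 < r -> exists N,
    forall j k, (N <= j)%N -> (N <= k)%N -> rnorm (u j - u k) < r) ->
  exists x : V, u @ \oo --> x.
Proof.
move=> h; suff hc : @cauchy V (fmap u \oo).
  by exists (lim (u @ \oo)); exact: (@cauchy_cvg V _ _ hc).
apply: cauchy_exP => r /= r0.
have rE : r = (complex.Re r)%:C by rewrite RRe_real // gtr0_real.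
have r0' : 0 < complex.Re r by rewrite -ltcR -rE.
have [N hN] := h _ r0'; exists (u N); exists N => // k /= Nk.
by rewrite -ball_normE /= rnormE rE ltcR hN.
Qed.

Section Linear.
Context {R : realType} {V W : lmodType R[i]} {A : V -> W}.
Hypothesis lA : linear A.

Lemma lin0 : A 0 = 0.
Proof. by have := lA (-1) 0 0; rewrite scaler0 addr0 scaleN1r addNr. Qed.

Lemma linZ c x : A (c *: x) = c *: A x.
Proof. by rewrite -[c *: x]addr0 lA lin0 addr0. Qed.

Lemma linD x y : A (x + y) = A x + A y.
Proof. by rewrite -[x in LHS]scale1r lA scale1r. Qed.

Lemma linB x y : A (x - y) = A x - A y.
Proof. by rewrite linD -scaleN1r linZ scaleN1r. Qed.

Lemma lin_sum (I : Type) (s : seq I) (P : pred I) (F : I -> V) :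
  A (\sum_(i <- s | P i) F i) = \sum_(i <- s | P i) A (F i).
Proof. exact: (big_morph A linD lin0). Qed.

Lemma lin_comb (I : Type) (s : seq I) (P : pred I) (c : I -> R[i])
    (F : I -> V) :
  A (\sum_(i <- s | P i) c i *: F i) = \sum_(i <- s | P i) c i *: A (F i).
Proof. by rewrite lin_sum; apply: eq_bigr => i _; rewrite linZ. Qed.

End Linear.

Section BoundedOp.
Context {R : realType} {V : hilbertType R}.
Implicit Types (A B : V -> V) (D : set V) (x y : V).

(** The usual scaling argument; it turns continuity, which is stated with
    neighbourhoods, into the inequality that every later estimate uses. *)
Lemma bounded_opP A : bounded_op A <->
  linear A /\ exists2 M : R, 0 <= M & forall x, rnorm (A x) <= M * rnorm x.
Proof.
split=> -[lA hA]; split=> //.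
- have [r r0 hr] : exists2 r : R, 0 < r &
      forall y, rnorm (0 - y) < r -> rnorm (A y) < 1.
    have : nbhs (A 0) [set z | rnorm z < 1].
      apply/nbhs_rnorm; exists 1 => // z; rewrite lin0 // sub0r rnormN //.
    by move=> /hA /nbhs_rnorm.
  exists (2 / r) => [|x]; first by rewrite divr_ge0 // ltW.
  have [x0|x0] := eqVneq (rnorm x) 0.
    by rewrite (rnorm_eq0 x0) lin0 // !rnorm0 mulr0.
  have xp : 0 < rnorm x by rewrite lt0r x0 rnorm_ge0.
  have cp : 0 < r / (2 * rnorm x) by rewrite divr_gt0 // mulr_gt0.
  have := hr ((r / (2 * rnorm x))%:C *: x); rewrite sub0r rnormN rnormZ.
  rewrite linZ // rnormZ rnorm_real gtr0_norm //.
  have -> : r / (2 * rnorm x) * rnorm x = r / 2 by field.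
  have -> : (2 / r * rnorm x) = (r / (2 * rnorm x))^-1.
    by rewrite invf_div mulrAC.
  move=> /(_ ltac:(lra)) /ltW h.
  by rewrite -[leRHS]mulr1 mulrC ler_pdivlMr // mulrC.
- have [M M0 hM] := hA; move=> x B /nbhs_rnorm[r r0 hB].
  apply/nbhs_rnorm; exists (r / (M + 1)) => [|y xy].
    by rewrite divr_gt0 //; lra.
  apply: hB; rewrite -linB //; apply: (le_lt_trans (hM _)).
  have M1 : 0 < M + 1 by lra.
  move: xy; rewrite ltr_pdivlMr //; have := rnorm_ge0 (x - y).
  by move=> ? ?; nra.
Qed.

End BoundedOp.

(** * Inner products *)

Section Inner.
Context {R : realType} {V : hilbertType R}.
Implicit Types (x y z : V) (c : R[i]).

Lemma innerDl x y z : inner (x + y) z = inner x z + inner y z.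
Proof. exact: linearDl. Qed.
Lemma innerDr x y z : inner x (y + z) = inner x y + inner x z.
Proof. exact: linearDr. Qed.
Lemma innerBl x y z : inner (x - y) z = inner x z - inner y z.
Proof. exact: linearBl. Qed.
Lemma innerBr x y z : inner x (y - z) = inner x y - inner x z.
Proof. exact: linearBr. Qed.
Lemma inner0l z : inner 0 z = 0 :> R[i].
Proof. exact: linear0l. Qed.
Lemma inner0r z : inner z 0 = 0 :> R[i].
Proof. exact: linear0r. Qed.
Lemma innerZl c x y : inner (c *: x) y = c * inner x y.
Proof. exact: linearZl_LR. Qed.
Lemma innerZr c x y : inner x (c *: y) = c^*%R * inner x y.
Proof. exact: linearZr_LR. Qed.
Lemma innerC x y : inner x y = (inner y x)^*%R.
Proof. by rewrite hermC /= expr0 mul1r. Qed.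
Lemma inner_suml (I : Type) (s : seq I) (P : pred I) (F : I -> V) y :
  inner (\sum_(i <- s | P i) F i) y = \sum_(i <- s | P i) inner (F i) y.
Proof. exact: linear_sumlz. Qed.
Lemma inner_sumr (I : Type) (s : seq I) (P : pred I) (F : I -> V) y :
  inner y (\sum_(i <- s | P i) F i) = \sum_(i <- s | P i) inner y (F i).
Proof. exact: linear_sumr. Qed.

Lemma inner_rnorm x : inner x x = (rnorm x ^+ 2)%:C.
Proof. by rewrite innerE rnormE rmorphXn. Qed.

Lemma rnorm_sqr x : rnorm x ^+ 2 = complex.Re (inner x x).
Proof. by rewrite inner_rnorm. Qed.

Lemma unit_rnorm x : inner x x = 1 -> rnorm x = 1.
Proof.
move=> x1; apply/eqP.
by rewrite -(@eqrXn2 _ 2) ?rnorm_ge0 // expr1n rnorm_sqr x1.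
Qed.

Lemma rnorm_sqrD x y :
  rnorm (x + y) ^+ 2 = rnorm x ^+ 2 + rnorm y ^+ 2 + 2 * complex.Re (inner x y).
Proof.
rewrite !rnorm_sqr innerDl !innerDr !ReD [inner y x]innerC Re_conjC.
by ring.
Qed.

Lemma rnorm_sqrB x y :
  rnorm (x - y) ^+ 2 = rnorm x ^+ 2 + rnorm y ^+ 2 - 2 * complex.Re (inner x y).
Proof.
rewrite !rnorm_sqr innerBl !innerBr !ReB [inner y x]innerC Re_conjC.
by ring.
Qed.

Lemma cauchy_schwarz x y : rnorm (inner x y) <= rnorm x * rnorm y.
Proof.
have [y0|y0] := eqVneq (rnorm y) 0.
  by rewrite (rnorm_eq0 y0) inner0r !rnorm0 mulr0.
have yp : 0 < rnorm y by rewrite lt0r y0 rnorm_ge0.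
set a := inner x y.
have aE : a * a^*%R = (rnorm a ^+ 2)%:C by rewrite -normCK rnormE rmorphXn.
have := sqr_ge0 (rnorm (x - (a / (rnorm y ^+ 2)%:C) *: y)).
rewrite rnorm_sqrB rnormZ innerZr -/a rnormM.
have -> : (a / (rnorm y ^+ 2)%:C)^*%R * a = (rnorm a ^+ 2 / rnorm y ^+ 2)%:C.
  rewrite rmorphM fmorphV /= mulrAC [_ * a]mulrC aE conjC_real.
  by rewrite [RHS]rmorphM fmorphV.
have -> : rnorm (((rnorm y ^+ 2)%:C)^-1 : R[i]) = (rnorm y ^+ 2)^-1.
  by rewrite -fmorphV rnorm_real ger0_norm // invr_ge0 sqr_ge0.
have -> : (rnorm a / rnorm y ^+ 2 * rnorm y) ^+ 2 = rnorm a ^+ 2 / rnorm y ^+ 2.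
  by field.
rewrite /= => h; rewrite -(@ler_pXn2r _ 2) ?nnegrE ?mulr_ge0 ?rnorm_ge0 //.
rewrite exprMn -ler_pdivrMr ?exprn_gt0 //; lra.
Qed.

End Inner.

(** * Extension by continuity from a total family *)

Section Total.
Context {R : realType} {V : hilbertType R} {I : Type} {t : I -> V}.
Hypothesis total_t : closure (lspan (range t)) = setT.

Lemma total_approx (x : V) (r : R) : 0 < r ->
  exists m (c : 'I_m -> R[i]) (v : 'I_m -> I),
    rnorm (x - \sum_(j < m) c j *: t (v j)) < r.
Proof.
move=> r0; have : closure (lspan (range t)) x by rewrite total_t.
move=> /closure_rnorm /(_ _ r0)[_ [m [c [v [hv ->]]]] xr].
have /choice[w hw] : forall j, exists i, t i = v j.
  by move=> j; have [i _ <-] := hv j; exists i.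
exists m, c, w; rewrite (eq_bigr (fun j => c j *: v j)) // => j _.
by rewrite hw.
Qed.

Lemma total_eq0 (W : normedModType R[i]) (phi : V -> W) (M : R) :
  linear phi -> 0 <= M -> (forall x, rnorm (phi x) <= M * rnorm x) ->
  (forall i, phi (t i) = 0) -> forall x, phi x = 0.
Proof.
move=> lphi M0 hM h0 x; apply: rnorm_eq0; apply/eqP.
rewrite eq_le rnorm_ge0 andbT.
apply/ler_addgt0Pr => r r0; rewrite add0r.
have [|m [c [v hv]]] := total_approx x (r := r / (M + 1)).
  by rewrite divr_gt0 //; lra.
have -> : phi x = phi (x - \sum_(j < m) c j *: t (v j)).
  by rewrite linB // lin_comb // big1 ?subr0 // => j _; rewrite h0 scaler0.
apply: (le_trans (hM _)).
move: hv; rewrite ltr_pdivlMr; last lra.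
have := rnorm_ge0 (x - \sum_(j < m) c j *: t (v j)).
by move=> ? ?; nra.
Qed.

Lemma total_op_eq (A B : V -> V) : bounded_op A -> bounded_op B ->
  (forall i, A (t i) = B (t i)) -> A = B.
Proof.
move=> /bounded_opP[lA [M M0 hM]] /bounded_opP[lB [N N0 hN]] h.
apply/funext => x; apply/eqP; rewrite -subr_eq0; apply/eqP; move: x.
apply: (@total_eq0 _ (fun x => A x - B x) (M + N)).
- by move=> a x y; rewrite lA lB scalerBr opprD addrACA.
- exact: addr_ge0.
- move=> x; rewrite mulrDl (le_trans (rnormD _ _)) // rnormN.
  by rewrite lerD.
- by move=> i; rewrite h subrr.
Qed.

(** An operator is determined by its values on a total family, and prescribed
    values extend as soon as the bound holds on finite combinations. This one
    principle produces the adjoint of the shift, the tensor products of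
    operators and the permutation operators. The graph [G] on the span is
    linear with [|y| <= M |x|]; its closure [P] is then again the graph of a
    function, and completeness makes that function total. *)
Lemma total_extend (g : I -> V) (M : R) : 0 <= M ->
  (forall m (c : 'I_m -> R[i]) (v : 'I_m -> I),
    rnorm (\sum_(j < m) c j *: g (v j)) <=
    M * rnorm (\sum_(j < m) c j *: t (v j))) ->
  exists B, [/\ bounded_op B, forall i, B (t i) = g i
    & forall x, rnorm (B x) <= M * rnorm x].
Proof.
move=> M0 hM.
pose G x y := exists m (c : 'I_m -> R[i]) (v : 'I_m -> I),
  x = \sum_(j < m) c j *: t (v j) /\ y = \sum_(j < m) c j *: g (v j).
have GM x y : G x y -> rnorm y <= M * rnorm x by move=> [m [c [v [-> ->]]]].
have GD a x y x' y' : G x y -> G x' y' -> G (a *: x + x') (a *: y + y').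
  move=> [m [c [v [-> ->]]]] [m' [c' [v' [-> ->]]]].
  exists (m + m')%N.
  exists (fun j =>
    match fintype.split j with inl k => a * c k | inr k => c' k end).
  exists (fun j => match fintype.split j with inl k => v k | inr k => v' k end).
  rewrite !big_split_ord !scaler_sumr; split; congr (_ + _);
    apply: eq_bigr => j _;
    by rewrite ?(unsplitK (inl j)) ?(unsplitK (inr j)) ?scalerA.
pose P x y := forall r, 0 < r ->
  exists x' y', [/\ G x' y', rnorm (x - x') < r & rnorm (y - y') < r].
have PG x y : G x y -> P x y.
  by move=> xy r r0; exists x, y; rewrite !subrr !rnorm0.
have PD a x y x' y' : P x y -> P x' y' -> P (a *: x + x') (a *: y + y').
  move=> xy xy' r r0; have a1 : 0 < rnorm a + 1 by have := rnorm_ge0 a; lra.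
  have [|x1 [y1 [h1 hx1 hy1]]] := xy (r / 2 / (rnorm a + 1)).
    by rewrite !divr_gt0.
  have [|x2 [y2 [h2 hx2 hy2]]] := xy' (r / 2); first by rewrite !divr_gt0.
  exists (a *: x1 + x2), (a *: y1 + y2); split; first exact: GD.
    rewrite opprD addrACA -scalerBr (le_lt_trans (rnormD _ _)) // rnormZ.
    move: hx1; rewrite ltr_pdivlMr //; have := rnorm_ge0 (x - x1); nra.
  rewrite opprD addrACA -scalerBr (le_lt_trans (rnormD _ _)) // rnormZ.
  move: hy1; rewrite ltr_pdivlMr //; have := rnorm_ge0 (y - y1); nra.
have PM x y : P x y -> rnorm y <= M * rnorm x.
  move=> xy; apply/ler_addgt0Pr => r r0.
  have [|x1 [y1 [h1 hx1 hy1]]] := xy (r / (M + 1)).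
    by rewrite divr_gt0 //; lra.
  have M1 : 0 < M + 1 by lra.
  move: hx1 hy1; rewrite !ltr_pdivlMr // => hx1 hy1.
  have := GM _ _ h1.
  have := rnormD (y - y1) y1; rewrite subrK.
  have := rnormD (x1 - x) x; rewrite subrK rdistC.
  have := rnorm_ge0 (x - x1); have := rnorm_ge0 (y - y1).
  nra.
have PT x : exists y, P x y.
  have /choice[u hu] : forall k : nat, exists p : V * V,
      G p.1 p.2 /\ rnorm (x - p.1) < k.+1%:R^-1.
    move=> k; have [|m [c [v hv]]] := total_approx x (r := k.+1%:R^-1).
      by rewrite invr_gt0.
    exists (\sum_(j < m) c j *: t (v j), \sum_(j < m) c j *: g (v j)).
    by split=> //; exists m, c, v.
  have small r : 0 < r -> exists N, forall k, (N <= k)%N -> k.+1%:R^-1 < r :> R.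
    move=> r0; have /cvgrPdist_lt/(_ _ r0)[N _ hN] := @cvg_harmonic R.
    exists N => k /hN; rewrite /= sub0r normrN ger0_norm //.
  have [y hy] : exists y : V, (fun k => (u k).2) @ \oo --> y.
    apply: cauchy_rnorm => r r0.
    have [|N hN] := small (r / (2 * (M + 1))).
      by rewrite divr_gt0 //; lra.
    exists N => j k /hN hj /hN hk.
    have := GD (-1) _ _ _ _ (hu k).1 (hu j).1.
    rewrite !scaleN1r ![- _ + _]addrC.
    move=> /GM h; apply: (le_lt_trans h).
    have := rnormD ((u j).1 - x) (x - (u k).1).
    rewrite addrA subrK [rnorm (_ - x)]rdistC => h1.
    have := (hu j).2; have := (hu k).2 => h2 h3.
    have : rnorm ((u j).1 - (u k).1) < r / (M + 1).
      have -> : r / (M + 1) = r / (2 * (M + 1)) + r / (2 * (M + 1)).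
        by field; lra.
      apply: (le_lt_trans h1).
      by apply: ltrD; [exact: lt_trans h3 hj|exact: lt_trans h2 hk].
    rewrite ltr_pdivlMr; last lra.
    have := rnorm_ge0 ((u j).1 - (u k).1); nra.
  exists y => r r0; have [N hN] := small _ r0.
  have /cvg_rnorm/(_ _ r0)[N' hN'] := hy.
  have [h1 h2] := hu (maxn N N').
  exists (u (maxn N N')).1, (u (maxn N N')).2; split=> //.
    by apply: (lt_trans h2); apply: hN; rewrite leq_maxl.
  by apply: hN'; rewrite leq_maxr.
have [B hB] := choice PT.
have PU x y : P x y -> B x = y.
  move=> xy; have := PD (-1) _ _ _ _ xy (hB x); rewrite !scaleN1r addNr.
  move=> /PM; rewrite rnorm0 mulr0 => h.
  apply/eqP; rewrite -subr_eq0; apply/eqP; rewrite addrC; apply: rnorm_eq0.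
  by apply/eqP; rewrite eq_le h rnorm_ge0.
have BM x : rnorm (B x) <= M * rnorm x by exact: PM.
exists B; split=> //.
- apply/bounded_opP; split; last by exists M.
  by move=> a x y; apply: PU; exact: PD.
- move=> i; apply: PU; apply: PG; exists 1%N, (fun=> 1), (fun=> i).
  by rewrite !big_ord1 !scale1r.
Qed.

End Total.

(** * Products of positive semidefinite kernels *)

Section Psd.
Context {R : realType}.

Definition psd m (D : 'I_m -> 'I_m -> R[i]) :=
  forall c : 'I_m -> R[i], 0 <= \sum_i \sum_j c i * (c j)^*%R * D i j.

(** The Schur product theorem for a Gram matrix. Gram-Schmidt step: for a unit
    vector [u], the Gram matrix of [v] is that of its component along [u], of
    rank one, plus that of [v i - q i *: u]. The rank-one part only changes the
    test vector from [c] to [c * q]; the other part has one more zero vector. *)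
Lemma psd_gram (V : hilbertType R) m (D : 'I_m -> 'I_m -> R[i])
    (v : 'I_m -> V) :
  psd D -> psd (fun i j => D i j * inner (v i) (v j)).
Proof.
move=> psdD; suff main k : forall v : 'I_m -> V,
    (forall i : 'I_m, (k <= i)%N -> v i = 0) ->
    psd (fun i j => D i j * inner (v i) (v j)).
  by apply: (main m) => i; rewrite leqNgt ltn_ord.
elim: k => [|k IHk] {}v v0 c.
  rewrite big1 // => i _; rewrite big1 // => j _.
  by rewrite v0 // inner0l !mulr0.
have [mk|km] := leqP m k.
  by apply: IHk => i ki; have := leq_trans (ltn_ord i) mk; rewrite ltnNge ki.
pose i0 := Ordinal km; pose N := (rnorm (v i0))%:C.
have [Nv|Nv] := eqVneq (rnorm (v i0)) 0.
  apply: IHk => i; rewrite leq_eqVlt => /predU1P[ki|]; last exact: v0.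
  by rewrite (_ : i = i0) ?(rnorm_eq0 Nv) //; apply: val_inj.
have N0 : N != 0 by rewrite fmorph_eq0.
pose u := N^-1 *: v i0.
have vi0 : v i0 = N *: u by rewrite scalerA divff // scale1r.
have u1 : inner u u = 1.
  rewrite innerZl innerZr inner_rnorm fmorphV /= conjC_real /= mulrA -invfM.
  by rewrite rmorphXn /= -/N expr2 mulVf // mulf_neq0.
clearbody u.
pose q i := inner (v i) u.
pose w i := v i - q i *: u.
have wE i j : inner (v i) (v j) = q i * (q j)^*%R + inner (w i) (w j).
  rewrite /w innerBl !innerBr !innerZl !innerZr u1.
  rewrite -/(q i) [inner u _]innerC -/(q j).
  by ring.
have w0 (i : 'I_m) : (k <= i)%N -> w i = 0.
  rewrite leq_eqVlt => /predU1P[ki|ki]; last first.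
    by rewrite /w /q v0 // inner0l scale0r subrr.
  rewrite (_ : i = i0); last exact: val_inj.
  by rewrite /w /q vi0 innerZl u1 mulr1 subrr.
rewrite (_ : \sum_i _ =
   \sum_i \sum_j (c i * q i) * (c j * q j)^*%R * D i j +
   \sum_i \sum_j c i * (c j)^*%R * (D i j * inner (w i) (w j))).
  by apply: addr_ge0; [exact: psdD|exact: IHk].
rewrite -big_split; apply: eq_bigr => i _; rewrite -big_split.
by apply: eq_bigr => j _; rewrite wE rmorphM /=; ring.
Qed.

Lemma psd_prod_gram (V : hilbertType R) m (K : Type) (s : seq K)
    (D : 'I_m -> 'I_m -> R[i]) (v : 'I_m -> K -> V) : psd D ->
  psd (fun i j => D i j * \prod_(k <- s) inner (v i k) (v j k)).
Proof.
elim: s D => [|k s IHs] D psdD c.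
  under eq_bigr do under eq_bigr do rewrite big_nil mulr1.
  exact: psdD.
under eq_bigr do under eq_bigr do rewrite big_cons [X in _ * X]mulrA.
exact: (IHs _ (psd_gram (v ^~ k) psdD)).
Qed.

Lemma inner_comb (V : hilbertType R) m (c : 'I_m -> R[i]) (v : 'I_m -> V) :
  ((rnorm (\sum_j c j *: v j)) ^+ 2)%:C =
  \sum_i \sum_j c i * (c j)^*%R * inner (v i) (v j).
Proof.
rewrite -inner_rnorm inner_suml; apply: eq_bigr => i _.
rewrite inner_sumr; apply: eq_bigr => j _.
by rewrite innerZl innerZr mulrA.
Qed.

(** A combination of squared norms that is nonnegative on all vectors gives a
    positive semidefinite kernel: test it on [\sum_j c j *: v j]. *)
Lemma psd_forms (V : hilbertType R) m (v : 'I_m -> V) (J : finType)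
    (a : J -> R) (A : J -> V -> V) :
  (forall r, linear (A r)) ->
  (forall h, 0 <= \sum_r a r * rnorm (A r h) ^+ 2) ->
  psd (fun i j => \sum_r (a r)%:C * inner (A r (v i)) (A r (v j))).
Proof.
move=> lA ge0 c.
rewrite (_ : \sum_i _ = (\sum_r a r * rnorm (A r (\sum_j c j *: v j)) ^+ 2)%:C).
  by rewrite ler0c.
rewrite rmorph_sum /=.
under [RHS]eq_bigr do rewrite lin_comb // rmorphM /= inner_comb mulr_sumr.
rewrite [RHS]exchange_big; apply: eq_bigr => i _.
under [RHS]eq_bigr do rewrite mulr_sumr.
rewrite [RHS]exchange_big; apply: eq_bigr => j _.
by rewrite mulr_sumr; apply: eq_bigr => r _; ring.
Qed.

End Psd.

Section Continuity.
Context {R : realType} {V : hilbertType R}.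

Lemma rnorm_continuous (W : normedModType R[i]) : continuous (rnorm : W -> R).
Proof.
move=> x; apply/cvgrPdist_lt => r r0; apply/nbhs_rnorm; exists r => // y xy.
apply: le_lt_trans xy; rewrite ler_distl.
have := rnormD (x - y) y; have := rnormD (y - x) x.
rewrite !subrK [rnorm (y - x)]rdistC; lra.
Qed.

Lemma total_ge0 (I : Type) (t : I -> V) (f : V -> R) :
  closure (lspan (range t)) = setT -> continuous f ->
  (forall m (c : 'I_m -> R[i]) (v : 'I_m -> I),
    0 <= f (\sum_j c j *: t (v j))) ->
  forall x, 0 <= f x.
Proof.
move=> tot cf h x; rewrite leNgt; apply/negP => fx.
have : nbhs (f x) [set y | y < 0] by exact: lt_nbhsl.
move=> /cf /nbhs_rnorm[r r0 hr].
have [m [c [v /hr /=]]] := total_approx tot x r0.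
by rewrite ltNge h.
Qed.

Lemma form_continuous (J : finType) (a : J -> R) (A : J -> V -> V) :
  (forall r, bounded_op (A r)) ->
  continuous (fun x => \sum_r a r * rnorm (A r x) ^+ 2).
Proof.
move=> bA x; apply: cvg_big => [|r _]; first exact: add_continuous.
apply: cvgM; first exact: cvg_cst.
have cr : {for x, continuous (fun x => rnorm (A r x))}.
  by apply: continuous_comp; [exact: (bA r).2|exact: rnorm_continuous].
by rewrite expr2; apply: cvgM.
Qed.

Lemma bounded_id : bounded_op (id : V -> V).
Proof. by split=> // x. Qed.

Lemma bounded_comp (A B : V -> V) :
  bounded_op A -> bounded_op B -> bounded_op (A \o B).
Proof.
move=> [lA cA] [lB cB]; split; first by move=> a x y /=; rewrite lB lA.
by move=> x; apply: continuous_comp; [exact: cB|exact: cA].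
Qed.

Lemma bounded_iter (A : V -> V) k : bounded_op A -> bounded_op (iter k A).
Proof.
move=> bA; elim: k => [|k IHk]; first exact: bounded_id.
exact: (bounded_comp bA IHk).
Qed.

End Continuity.

(** * Operators on the tensor power *)

Section Tensor.
Context {R : realType} {H T : hilbertType R} {n : nat}.
Variable tens : ('I_n -> H) -> T.
Hypothesis tensP : tensor_power tens.

Lemma tens_inner v w :
  inner (tens v) (tens w) = \prod_(i < n) inner (v i) (w i).
Proof. by case: tensP. Qed.

Lemma tens_total : closure (lspan (range tens)) = setT.
Proof. by case: tensP. Qed.

Definition at_slot (k : 'I_n) (A : H -> H) : 'I_n -> H -> H :=
  fun i => if i == k then A else id.

(** By the product formula for inner products, the kernel of the form on the
    tensors is the kernel of the form at the slot [k], times the Gram matrices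
    of the other slots; the Schur product theorem keeps it nonnegative. *)
Lemma slot_forms_span (J : finType) (a : J -> R) (A : J -> H -> H) (k : 'I_n) :
  (forall r, linear (A r)) ->
  (forall h, 0 <= \sum_r a r * rnorm (A r h) ^+ 2) ->
  forall m (c : 'I_m -> R[i]) (v : 'I_m -> 'I_n -> H),
  0 <= \sum_r a r *
    rnorm (\sum_j c j *: tens (fun i => at_slot k (A r) i (v j i))) ^+ 2.
Proof.
move=> lA ge0 m c v; rewrite -ler0c rmorph_sum /=.
have psdD := psd_prod_gram [seq i <- index_enum 'I_n | i != k] v
  (psd_forms (v ^~ k) lA ge0).
move: (psdD c); congr (0 <= _); apply: esym.
under eq_bigr do rewrite rmorphM /= inner_comb mulr_sumr.
rewrite exchange_big; apply: eq_bigr => i _.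
under eq_bigr do rewrite mulr_sumr.
rewrite exchange_big; apply: eq_bigr => j _.
rewrite mulr_suml mulr_sumr; apply: eq_bigr => r _.
rewrite tens_inner (bigD1 k) //= big_filter /at_slot eqxx.
under eq_bigr => i' /negbTE -> do [].
by ring.
Qed.

(** The operators are switched on one slot at a time; each step is the previous
    lemma for the form [M k ^+ 2 * |h| ^+ 2 - |A k h| ^+ 2]. *)
Lemma tens_comb_le (A : 'I_n -> H -> H) (M : 'I_n -> R) :
  (forall i, linear (A i)) -> (forall i, 0 <= M i) ->
  (forall i h, rnorm (A i h) <= M i * rnorm h) ->
  forall m (c : 'I_m -> R[i]) (v : 'I_m -> 'I_n -> H),
  rnorm (\sum_j c j *: tens (fun i => A i (v j i))) <=
  (\prod_i M i) * rnorm (\sum_j c j *: tens (v j)).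
Proof.
move=> lA M0 hM m c v.
pose Ak k : 'I_n -> H -> H := fun i => if (i < k)%N then A i else id.
suff main k : (k <= n)%N ->
    rnorm (\sum_j c j *: tens (fun i => Ak k i (v j i))) <=
    (\prod_(i < n | (i < k)%N) M i) * rnorm (\sum_j c j *: tens (v j)).
  have := main n (leqnn n).
  rewrite [X in _ <= X * _ -> _](eq_bigl predT); last first.
    by move=> i; rewrite ltn_ord.
  congr (rnorm _ <= _); apply: eq_bigr => j _; congr (_ *: tens _).
  by apply/funext => i; rewrite /Ak ltn_ord.
elim: k => [|k IHk] kn.
  rewrite [X in _ <= X * _]big1 ?mul1r => [|i //].
  by rewrite (eq_bigr (fun j => c j *: tens (v j))).
pose k0 := Ordinal kn.
move: IHk => /(_ (ltnW kn)) IHk; rewrite [X in _ <= X * _](bigD1 k0) //=.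
rewrite [X in _ * X * _](_ : _ = \prod_(i < n | (i < k)%N) M i); last first.
  by apply: eq_bigl => i; rewrite ltnS andbC ltn_neqAle -val_eqE.
rewrite -mulrA; apply: (le_trans _ (ler_wpM2l (M0 k0) IHk)).
have lb (b : bool) : linear (if b then id else A k0) by case: b.
have ge0 h : 0 <= \sum_(b : bool) (if b then M k0 ^+ 2 else - 1) *
    rnorm ((if b then id else A k0) h) ^+ 2.
  rewrite big_bool /= mulN1r subr_ge0 -exprMn ler_pXn2r ?nnegrE ?rnorm_ge0 //.
  by rewrite mulr_ge0 // rnorm_ge0.
have := slot_forms_span k0 lb ge0 c (fun j i => Ak k i (v j i)).
rewrite big_bool /= mulN1r subr_ge0 -exprMn.
rewrite ler_pXn2r ?nnegrE ?rnorm_ge0 //; last first.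
  by rewrite mulr_ge0 // rnorm_ge0.
set X := rnorm _; set Y := rnorm _; set X' := rnorm _; set Y' := rnorm _.
rewrite (_ : X = X'); last first.
  congr rnorm; apply: eq_bigr => j _; congr (_ *: tens _); apply/funext => i.
  rewrite /at_slot /Ak ltnS [(i <= k)%N]leq_eqVlt -val_eqE /=.
  have [h|//] := eqVneq (val i) k.
  by rewrite h ltnn; congr (A _ _); apply: val_inj.
rewrite (_ : Y = Y') //; congr rnorm; apply: eq_bigr => j _.
by congr (_ *: tens _); apply/funext => i; rewrite /at_slot; case: ifP.
Qed.

Lemma tens_extendP (f : ('I_n -> H) -> 'I_n -> H) (M : R) : 0 <= M ->
  (forall m (c : 'I_m -> R[i]) (v : 'I_m -> 'I_n -> H),
    rnorm (\sum_j c j *: tens (f (v j))) <=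
    M * rnorm (\sum_j c j *: tens (v j))) ->
  [/\ bounded_op (tens_extend tens f),
      forall v, tens_extend tens f (tens v) = tens (f v)
    & forall x, rnorm (tens_extend tens f x) <= M * rnorm x].
Proof.
move=> M0 hM.
have [B [bB hB nB]] :=
  total_extend tens_total (g := fun v => tens (f v)) M0 hM.
suff -> : tens_extend tens f = B by [].
have [|b h] := @getPex _ [set B : T -> T | bounded_op B /\
  forall v, B (tens v) = tens (f v)]; first by exists B.
by apply: (total_op_eq tens_total) => // v; rewrite hB; exact: h.
Qed.

Lemma tens_opP (A : 'I_n -> H -> H) (M : 'I_n -> R) :
  (forall i, linear (A i)) -> (forall i, 0 <= M i) ->
  (forall i h, rnorm (A i h) <= M i * rnorm h) ->
  [/\ bounded_op (tens_op tens A),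
      forall v, tens_op tens A (tens v) = tens (fun i => A i (v i))
    & forall x, rnorm (tens_op tens A x) <= (\prod_i M i) * rnorm x].
Proof.
move=> lA M0 hM; apply: tens_extendP; first exact: prodr_ge0.
exact: tens_comb_le.
Qed.

Lemma bounded_opsP (A : 'I_n -> H -> H) : (forall i, bounded_op (A i)) ->
  exists M : 'I_n -> R, (forall i, 0 <= M i) /\
    forall i h, rnorm (A i h) <= M i * rnorm h.
Proof.
move=> bA; have /choice[M hM] : forall i, exists M : R, 0 <= M /\
    forall h, rnorm (A i h) <= M * rnorm h.
  by move=> i; have /bounded_opP[_ [M ? ?]] := bA i; exists M.
by exists M; split=> i; have [] := hM i.
Qed.

Lemma tens_op_bounded (A : 'I_n -> H -> H) : (forall i, bounded_op (A i)) ->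
  bounded_op (tens_op tens A).
Proof.
move=> bA; have [M [M0 hM]] := bounded_opsP bA.
by case: (tens_opP _ M0 hM) => // i; case: (bA i).
Qed.

Lemma tens_op_tens (A : 'I_n -> H -> H) : (forall i, bounded_op (A i)) ->
  forall v, tens_op tens A (tens v) = tens (fun i => A i (v i)).
Proof.
move=> bA; have [M [M0 hM]] := bounded_opsP bA.
by case: (tens_opP _ M0 hM) => // i; case: (bA i).
Qed.

Lemma tens_op_comp (A B : 'I_n -> H -> H) :
  (forall i, bounded_op (A i)) -> (forall i, bounded_op (B i)) ->
  tens_op tens A \o tens_op tens B = tens_op tens (fun i => A i \o B i).
Proof.
move=> bA bB; have bAB i : bounded_op (A i \o B i) by exact: bounded_comp.
apply: (total_op_eq tens_total).
- by apply: bounded_comp; exact: tens_op_bounded.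
- exact: tens_op_bounded.
- by move=> v /=; rewrite !tens_op_tens.
Qed.

Lemma tens_op_id : tens_op tens (fun=> id) = id.
Proof.
apply: (total_op_eq tens_total).
- by apply: tens_op_bounded => i; exact: bounded_id.
- exact: bounded_id.
- by move=> v /=; rewrite tens_op_tens // => i; exact: bounded_id.
Qed.

Lemma at_slot_bounded k A :
  bounded_op A -> forall i, bounded_op (at_slot k A i).
Proof.
by move=> bA i; rewrite /at_slot; case: ifP => // _; exact: bounded_id.
Qed.

Lemma tens_op_slot_id k : tens_op tens (at_slot k id) = id.
Proof.
rewrite -[RHS]tens_op_id; congr (tens_op tens _); apply/funext => i.
by rewrite /at_slot if_same.
Qed.

(** Every quadratic inequality between operators on [H] holds for the same
    operators acting on one tensor factor. This replaces spectral or orthogonal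
    decompositions of the tensor power in all that follows. *)
Lemma slot_forms (J : finType) (a : J -> R) (A : J -> H -> H) (k : 'I_n) :
  (forall r, bounded_op (A r)) ->
  (forall h, 0 <= \sum_r a r * rnorm (A r h) ^+ 2) ->
  forall x, 0 <= \sum_r a r * rnorm (tens_op tens (at_slot k (A r)) x) ^+ 2.
Proof.
move=> bA ge0; have bA' r := at_slot_bounded k (bA r).
apply: (total_ge0 tens_total).
  by apply: form_continuous => r; exact: tens_op_bounded.
move=> m c v; rewrite (eq_bigr (fun r => a r * rnorm
    (\sum_j c j *: tens (fun i => at_slot k (A r) i (v j i))) ^+ 2)).
  by apply: slot_forms_span => // r; case: (bA r).
move=> r _; rewrite lin_comb; last exact: (tens_op_bounded (bA' r)).1.
by under eq_bigr do rewrite tens_op_tens //.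
Qed.

Lemma perm_opP (s : 'S_n) :
  bounded_op (perm_op tens s) /\
  forall v, perm_op tens s (tens v) = tens (v \o s).
Proof.
have [//||? ? _] := @tens_extendP (fun v => v \o s) 1; last by [].
move=> m c v; rewrite mul1r -(@ler_pXn2r _ 2) ?nnegrE ?rnorm_ge0 //.
rewrite -lecR !inner_comb le_eqVlt (_ : _ == _) //; apply/eqP.
apply: eq_bigr => i _; apply: eq_bigr => j _; congr (_ * _).
by rewrite !tens_inner [RHS](reindex_inj (@perm_inj _ s)).
Qed.

End Tensor.

(** * Operator norms as suprema *)

Section OpNorm.
Context {R : realType} {V : hilbertType R}.
Variables (D : set V) (A : V -> V).

Lemma le_opnorm_on (c : R) (x : V) : 0 <= c ->
  (forall x, rnorm (A x) <= c * rnorm x) -> D x -> rnorm x <= 1 ->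
  rnorm (A x) <= opnorm_on D A.
Proof.
move=> c0 hc Dx x1; apply: ub_le_sup; last by exists x.
exists c => _ [y [Dy y1] <-]; apply: (le_trans (hc y)).
by rewrite ler_piMr.
Qed.

Lemma opnorm_on_le (c : R) : D 0 ->
  (forall x, D x -> rnorm x <= 1 -> rnorm (A x) <= c) -> opnorm_on D A <= c.
Proof.
move=> D0 hc; apply: ge_sup.
  by exists (rnorm (A 0)); exists 0; rewrite //= rnorm0.
by move=> _ [y [Dy y1] <-]; exact: hc.
Qed.

End OpNorm.

(** * Forms that are diagonal in the basis *)

Section Basis.
Context {R : realType} {H : hilbertType R} {e : nat -> H}.
Hypothesis onb : orthonormal_basis e.

Lemma basis_inner i j : inner (e i) (e j) = (i == j)%:R.
Proof. by case: onb. Qed.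

Lemma basis_total : closure (lspan (range e)) = setT.
Proof. by case: onb. Qed.

Lemma basis_rnorm i : rnorm (e i) = 1.
Proof. by apply: unit_rnorm; rewrite basis_inner eqxx. Qed.

Lemma rnorm_comb_basis m (c : 'I_m -> R[i]) (f : 'I_m -> nat) : injective f ->
  rnorm (\sum_j c j *: e (f j)) ^+ 2 = \sum_j rnorm (c j) ^+ 2.
Proof.
move=> inj_f; apply: complexI; rewrite inner_comb rmorph_sum /=.
apply: eq_bigr => i _; rewrite (bigD1 i) //= basis_inner eqxx mulr1 -normCK.
rewrite rnormE rmorphXn big1 ?addr0 // => j ji.
by rewrite basis_inner (inj_eq inj_f) eq_sym (negbTE ji) mulr0.
Qed.

(** If a quadratic form is diagonal in the basis with entries [d i >= 0], then on
    a finite combination of basis vectors, even with repetitions, it is the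
    squared norm of the combination with the weights [sqrt (d i)]. The
    estimates on the shift and on the projections below are checked on basis
    vectors by means of it. *)
Lemma diagonal_forms (J : finType) (a : J -> R) (A : J -> H -> H)
    (d : nat -> R) :
  (forall r, bounded_op (A r)) -> (forall i, 0 <= d i) ->
  (forall i j, \sum_r (a r)%:C * inner (A r (e i)) (A r (e j)) =
    (i == j)%:R * (d i)%:C) ->
  forall h, 0 <= \sum_r a r * rnorm (A r h) ^+ 2.
Proof.
move=> bA d0 hd; apply: (total_ge0 basis_total); first exact: form_continuous.
move=> m c v.
suff -> : \sum_r a r * rnorm (A r (\sum_j c j *: e (v j))) ^+ 2 =
    rnorm (\sum_j c j *: ((Num.sqrt (d (v j)))%:C *: e (v j))) ^+ 2.
  exact: sqr_ge0.
apply: complexI; rewrite rmorph_sum inner_comb /=.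
under eq_bigr => r _.
  rewrite lin_comb; last exact: (bA r).1.
  rewrite rmorphM /= inner_comb mulr_sumr.
  over.
rewrite exchange_big; apply: eq_bigr => i _.
under eq_bigr do rewrite mulr_sumr.
rewrite exchange_big; apply: eq_bigr => j _.
under eq_bigr do rewrite mulrCA.
rewrite -mulr_sumr hd; congr (_ * _).
rewrite innerZl innerZr conjC_real basis_inner.
have [->|_] := eqVneq (v i) (v j); last by rewrite !(mulr0, mul0r).
by rewrite mul1r mulr1 -rmorphM /= -expr2 sqr_sqrtr.
Qed.

Lemma basis_inner_eq (A B : H -> H) y z : bounded_op A -> bounded_op B ->
  (forall i, inner (A (e i)) y = inner (B (e i)) z) ->
  forall x, inner (A x) y = inner (B x) z.
Proof.
move=> /bounded_opP[lA [M M0 hM]] /bounded_opP[lB [N N0 hN]] h x.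
apply/eqP; rewrite -subr_eq0; apply/eqP.
apply: (total_eq0 basis_total (W := R[i]^o)
  (phi := fun x => inner (A x) y - inner (B x) z : R[i]^o)
  (M := M * rnorm y + N * rnorm z)) => {x}.
- move=> a u v; rewrite lA lB !innerDl !innerZl /GRing.scale /=; ring.
- by rewrite addr_ge0 // mulr_ge0 // rnorm_ge0.
- move=> x; apply: (le_trans (rnormD _ _)); rewrite rnormN.
  have := cauchy_schwarz (A x) y; have := cauchy_schwarz (B x) z.
  have := ler_wpM2r (rnorm_ge0 y) (hM x).
  have := ler_wpM2r (rnorm_ge0 z) (hN x).
  by lra.
- by move=> i; rewrite h subrr.
Qed.

(** The projection onto the closed span of the [e i] with [K <= i]. *)
Definition tail (K : nat) (h : H) : H :=
  h - \sum_(i < K) inner h (e i) *: e i.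

Lemma tail_basis K i : tail K (e i) = if (K <= i)%N then e i else 0.
Proof.
rewrite /tail; case: leqP => Ki.
  rewrite big1 ?subr0 // => j _; rewrite basis_inner gtn_eqF ?scale0r //.
  exact: leq_trans (ltn_ord j) Ki.
rewrite (bigD1 (Ordinal Ki)) //= basis_inner eqxx scale1r big1 ?addr0 ?subrr //.
move=> j; rewrite -val_eqE /= => ji.
by rewrite basis_inner eq_sym (negbTE ji) scale0r.
Qed.

Lemma tail_bounded K : bounded_op (tail K).
Proof.
apply/bounded_opP; split.
  move=> a x y; rewrite /tail scalerBr addrACA -opprD; congr (_ - _).
  rewrite scaler_sumr -big_split; apply: eq_bigr => i _.
  by rewrite innerDl innerZl scalerDl scalerA.
exists (1 + K%:R) => [|x]; first by rewrite addr_ge0.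
rewrite (le_trans (rnormD _ _)) // rnormN mulrDl mul1r lerD2l.
apply: (le_trans (rnorm_sum _ _ _)).
rewrite -[K in leRHS]card_ord -sum1_card natr_sum mulr_suml.
apply: ler_sum => i _.
rewrite rnormZ basis_rnorm mulr1 mul1r.
by rewrite (le_trans (cauchy_schwarz _ _)) // basis_rnorm mulr1.
Qed.

Lemma tail0 : tail 0 = id.
Proof. by apply/funext => x; rewrite /tail big_ord0 subr0. Qed.

End Basis.
Arguments tail {R H} e K h.

(** * The weighted shift and its adjoint *)

Section Shift.
Context {R : realType} {H : hilbertType R} {e : nat -> H}.
Context {alpha : nat -> R[i]} {S : H -> H}.
Hypothesis onb : orthonormal_basis e.
Hypothesis wS : weighted_shift e alpha S.

Lemma shift_bounded : bounded_op S. Proof. by case: wS. Qed.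

Lemma shift_basis i : S (e i) = alpha i *: e i.+1. Proof. by case: wS. Qed.

Lemma shift_inner i j :
  inner (S (e i)) (S (e j)) = (i == j)%:R * (rnorm (alpha i) ^+ 2)%:C.
Proof.
rewrite !shift_basis innerZl innerZr (basis_inner onb) eqSS mulrA.
have [->|_] := eqVneq i j; last by rewrite mulr0 mul0r.
by rewrite mulr1 mul1r -normCK rnormE rmorphXn.
Qed.

Lemma tail_shift K : tail e K.+1 \o S = S \o tail e K.
Proof.
have bS := shift_bounded; have bQ := tail_bounded onb.
apply: (total_op_eq (basis_total onb)); [exact: bounded_comp..|move=> i /=].
rewrite shift_basis (linZ (bQ _).1) !(tail_basis onb) ltnS.
by case: ifP; rewrite ?shift_basis // scaler0 (lin0 bS.1).
Qed.

Lemma shift_le (M : R) : 0 <= M -> (forall i, rnorm (alpha i) <= M) ->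
  forall h, rnorm (S h) <= M * rnorm h.
Proof.
move=> M0 hM h.
rewrite -(@ler_pXn2r _ 2) ?nnegrE ?rnorm_ge0 ?mulr_ge0 ?rnorm_ge0 //.
rewrite exprMn.
have := @diagonal_forms _ _ _ onb bool (fun b => if b then M ^+ 2 else - 1)
  (fun b => if b then id else S) (fun i => M ^+ 2 - rnorm (alpha i) ^+ 2).
move=> /(_ _ _ _ h); rewrite big_bool /= mulN1r subr_ge0; apply.
- by case; [exact: bounded_id|exact: shift_bounded].
- by move=> i; rewrite subr_ge0 ler_pXn2r ?nnegrE ?rnorm_ge0.
- move=> i j; rewrite big_bool /= shift_inner (basis_inner onb).
  rewrite rmorphN1 rmorphB /=.
  by ring.
Qed.


(** The values [g i] of the adjoint on the basis are forced. If [y] is the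
    combination of them that corresponds to the combination [x] of basis
    vectors, then [<y, y> = <S y, x>], which bounds [|y|] by [M |x|]. *)
Lemma adjoint_exists : exists B, bounded_op B /\
  forall x y, inner (S x) y = inner x (B y).
Proof.
have [_ [M M0 hM]] := (bounded_opP S).1 shift_bounded.
pose g i := if i is j.+1 then (alpha j)^*%R *: e j else 0.
have Sg i x : inner (S x) (e i) = inner x (g i).
  apply: (basis_inner_eq onb shift_bounded bounded_id) => j.
  rewrite shift_basis innerZl (basis_inner onb).
  case: i => [|i] /=; first by rewrite inner0r mulr0.
  rewrite innerZr (basis_inner onb) eqSS conjCK.
  by have [->|_] := eqVneq j i; rewrite ?mulr0.
have [|B [bB hB nB]] := total_extend (basis_total onb) (g := g) M0.
  move=> m c v; set y := \sum_j _; set x := \sum_j _.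
  have yE : inner (S y) x = inner y y.
    rewrite inner_sumr /y [in RHS]inner_sumr; apply: eq_bigr => j _.
    by rewrite !innerZr Sg.
  have [->|y0] := eqVneq (rnorm y) 0; first by rewrite mulr_ge0 // rnorm_ge0.
  have yp : 0 < rnorm y by rewrite lt0r y0 rnorm_ge0.
  rewrite -(ler_pM2r yp) -expr2 rnorm_sqr -yE.
  apply: (le_trans (ler_norm _)); apply: (le_trans (Re_le_rnorm _)).
  apply: (le_trans (cauchy_schwarz _ _)).
  by rewrite mulrAC ler_wpM2r // rnorm_ge0.
exists B; split=> // x y; rewrite innerC [RHS]innerC; congr (_^*%R).
apply: esym; apply: (basis_inner_eq onb bB bounded_id) => i.
by rewrite hB innerC -Sg innerC conjCK.
Qed.

Lemma adjointP : bounded_op (adjoint S) /\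
  forall x y, inner (S x) y = inner x (adjoint S y).
Proof. exact: (getPex adjoint_exists). Qed.

Lemma adjoint_le (M : R) : 0 <= M -> (forall h, rnorm (S h) <= M * rnorm h) ->
  forall h, rnorm (adjoint S h) <= M * rnorm h.
Proof.
move=> M0 hM h; set y := adjoint S h.
have [->|y0] := eqVneq (rnorm y) 0; first by rewrite mulr_ge0 // rnorm_ge0.
have yp : 0 < rnorm y by rewrite lt0r y0 rnorm_ge0.
rewrite -(ler_pM2r yp) -expr2 rnorm_sqr -adjointP.2.
apply: (le_trans (ler_norm _)); apply: (le_trans (Re_le_rnorm _)).
apply: (le_trans (cauchy_schwarz _ _)).
by rewrite mulrAC ler_wpM2r // rnorm_ge0.
Qed.

Lemma adjoint_iter l x y :
  inner (iter l S x) y = inner x (iter l (adjoint S) y).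
Proof.
elim: l y => [//|l IHl] y.
by rewrite [in LHS]iterS adjointP.2 IHl -iterSr.
Qed.

End Shift.

(** * The gap for a weight that is not regular *)

Section Slot.
Context {R : realType} {H T : hilbertType R} {n : nat}.
Context {tens : ('I_n -> H) -> T}.
Hypothesis tensP : tensor_power tens.

Lemma slot_le (k : 'I_n) (A : H -> H) (M : R) : bounded_op A -> 0 <= M ->
  (forall h, rnorm (A h) <= M * rnorm h) ->
  forall x, rnorm (tens_op tens (at_slot k A) x) <= M * rnorm x.
Proof.
move=> bA M0 hM x.
have [|||_ _ h] := tens_opP tensP (A := at_slot k A)
    (M := fun i => if i == k then M else 1).
- by move=> i; exact: (at_slot_bounded k bA i).1.
- by move=> i; case: ifP.
- by move=> i y; rewrite /at_slot; case: ifP => // _; rewrite mul1r.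
- have := h x; rewrite (bigD1 k) //= eqxx big1 ?mulr1 // => i /negbTE -> //.
Qed.

Lemma slot_comp (k : 'I_n) (A B : H -> H) : bounded_op A -> bounded_op B ->
  tens_op tens (at_slot k A) \o tens_op tens (at_slot k B) =
  tens_op tens (at_slot k (A \o B)).
Proof.
move=> bA bB; rewrite tens_op_comp; try by [exact: at_slot_bounded|].
by congr tens_op; apply/funext => i; rewrite /at_slot; case: ifP.
Qed.

Lemma slot_commute (k k' : 'I_n) (A B : H -> H) : k != k' ->
  bounded_op A -> bounded_op B ->
  tens_op tens (at_slot k A) \o tens_op tens (at_slot k' B) =
  tens_op tens (at_slot k' B) \o tens_op tens (at_slot k A).
Proof.
move=> kk' bA bB; rewrite !tens_op_comp; try by [exact: at_slot_bounded|].
congr tens_op; apply/funext => i; rewrite /at_slot.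
have [->|_] := eqVneq i k; first by rewrite (negbTE kk').
by case: ifP.
Qed.

End Slot.

(** The setting of the descent: the weights are at most [M], and at most
    [mu < M] from the index [K] on; [A] and [B] are the shift acting on two
    different factors, and [Q k] is the projection [tail e k] acting on the same
    factor as [A]. *)
Section Gap.
Context {R : realType} {H T : hilbertType R} {e : nat -> H}.
Context {alpha : nat -> R[i]} {S : H -> H}.
Context {n : nat} {tens : ('I_n -> H) -> T}.
Hypothesis onb : orthonormal_basis e.
Hypothesis wS : weighted_shift e alpha S.
Hypothesis tensP : tensor_power tens.
Variables (M mu : R) (K : nat).
Hypothesis mu0 : 0 <= mu.
Hypothesis muM : mu < M.
Hypothesis alphaM : forall i, rnorm (alpha i) <= M.
Hypothesis alphamu : forall i, (K <= i)%N -> rnorm (alpha i) <= mu.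
Variables k1 k2 : 'I_n.
Hypothesis k12 : k1 != k2.

Let bS : bounded_op S := shift_bounded wS.
Let A := tens_op tens (at_slot k1 S).
Let B := tens_op tens (at_slot k2 S).
Let Q k := tens_op tens (at_slot k1 (tail e k)).

Let M0 : 0 <= M. Proof. by apply: le_trans mu0 _; exact: ltW. Qed.

Lemma tail_le k h : rnorm (tail e k h) <= rnorm h.
Proof.
rewrite -(@ler_pXn2r _ 2) ?nnegrE ?rnorm_ge0 //.
have := @diagonal_forms _ _ _ onb bool (fun b => if b then 1 else - 1)
  (fun b => if b then id else tail e k) (fun i => (i < k)%N%:R).
move=> /(_ _ _ _ h); rewrite big_bool /= mulN1r mul1r subr_ge0; apply.
- by case; [exact: bounded_id|exact: tail_bounded].
- by [].
- move=> i j; rewrite big_bool /= !(tail_basis onb) rmorphN1 mul1r mulN1r.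
  rewrite (basis_inner onb) rmorph_nat.
  have [->|ij] := eqVneq i j.
    by case: leqP;
      rewrite ?inner0l ?(basis_inner onb) ?eqxx ?subrr ?subr0 !mul1r.
  by do 2 (case: leqP => _); rewrite ?inner0l ?inner0r ?(basis_inner onb)
    ?(negbTE ij) ?subr0 ?mul0r.
Qed.

(** Mass of [x] beyond [K] in the factor of [A] costs norm: if [|A x|] is nearly
    [M |x|], then [Q K x] is small. *)
Lemma shift_tail_start x :
  (M ^+ 2 - mu ^+ 2) * rnorm (Q K x) ^+ 2 <=
  M ^+ 2 * rnorm x ^+ 2 - rnorm (A x) ^+ 2.
Proof.
have := @slot_forms _ _ _ _ _ tensP 'I_3
  (fun r => nth 0 [:: M ^+ 2; -1; - (M ^+ 2 - mu ^+ 2)] r)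
  (fun r => nth id [:: id; S; tail e K] r) k1.
move=> /(_ _ _ x); rewrite !big_ord_recl big_ord0 /= -/(A x) -/(Q K x).
rewrite (tens_op_slot_id tensP) => h.
suff : 0 <= M ^+ 2 * rnorm x ^+ 2 + (-1 * rnorm (A x) ^+ 2 +
  (- (M ^+ 2 - mu ^+ 2) * rnorm (Q K x) ^+ 2 + 0)) by lra.
apply: h.
  case=> [[|[|[|//]]]] _ /=; [exact: bounded_id|exact: bS|exact: tail_bounded].
apply: (diagonal_forms onb (d := fun i =>
  M ^+ 2 - rnorm (alpha i) ^+ 2 - (M ^+ 2 - mu ^+ 2) * (K <= i)%N%:R)).
- case=> [[|[|[|//]]]] _ /=; [exact: bounded_id|exact: bS|exact: tail_bounded].
- move=> i; have := alphaM i; have := @alphamu i; have := rnorm_ge0 (alpha i).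
  case: leqP => /= _ a0 amu aM.
    by have := amu isT => {}amu; nra.
  nra.
move=> i j; rewrite !big_ord_recl big_ord0 /= (shift_inner onb wS).
rewrite !(tail_basis onb).
rewrite (basis_inner onb).
have [->|ij] := eqVneq i j.
  case: leqP => _; rewrite ?inner0l ?(basis_inner onb) ?eqxx /=.
    by rewrite !(rmorphB, rmorphN, rmorphM, rmorph1) /=; ring.
  by rewrite !(rmorphB, rmorphN, rmorphM, rmorph1, rmorph0) /=; ring.
rewrite !mul0r !mulr0 !add0r addr0.
by do 2 (case: leqP => _); rewrite ?inner0l ?inner0r ?(basis_inner onb)
    ?(negbTE ij) ?mulr0.
Qed.

(** Since [Q k.+1] after [A] equals [A] after [Q k], the last term is what [A]
    makes of the part [Q k x]; if it is small while [|A x|] is nearly [M |x|],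
    then [Q k x] is small. *)
Lemma shift_tail_step k x :
  M ^+ 2 * rnorm (Q k x) ^+ 2 <=
  M ^+ 2 * rnorm x ^+ 2 - rnorm (A x) ^+ 2 + rnorm (Q k.+1 (A x)) ^+ 2.
Proof.
have bQ j := tail_bounded onb j.
rewrite -[Q k.+1 (A x)]/((Q k.+1 \o A) x).
rewrite (slot_comp tensP) ?(tail_shift onb wS) //.
have := @slot_forms _ _ _ _ _ tensP 'I_4
  (fun r => nth 0 [:: M ^+ 2; -1; - (M ^+ 2); 1] r)
  (fun r => nth id [:: id; S; tail e k; S \o tail e k] r) k1.
move=> /(_ _ _ x); rewrite !big_ord_recl big_ord0 /= -/(A x) -/(Q k x).
rewrite (tens_op_slot_id tensP).
set y := tens_op _ _ x => h.
suff : 0 <= M ^+ 2 * rnorm x ^+ 2 + (-1 * rnorm (A x) ^+ 2 +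
  (- M ^+ 2 * rnorm (Q k x) ^+ 2 + (1 * rnorm y ^+ 2 + 0))) by lra.
have bA (r : 'I_4) : bounded_op (nth id [:: id; S; tail e k; S \o tail e k] r).
  case: r => [[|[|[|[|//]]]]] _ /=;
    [exact: bounded_id|exact: bS|exact: bQ|exact: bounded_comp].
apply: h => //.
apply: (diagonal_forms onb (d := fun i =>
  (M ^+ 2 - rnorm (alpha i) ^+ 2) * (i < k)%N%:R)) => //.
- move=> i; have := alphaM i; have := rnorm_ge0 (alpha i) => a0 aM.
  by rewrite mulr_ge0 //; nra.
move=> i j; rewrite !big_ord_recl big_ord0 /= (shift_inner onb wS).
rewrite !(tail_basis onb).
rewrite (basis_inner onb).
have [->|ij] := eqVneq i j.
  case: leqP => _; rewrite ?(lin0 bS.1) ?inner0l ?(shift_inner onb wS)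
    ?(basis_inner onb) ?eqxx /=.
    by rewrite !(rmorphB, rmorphN, rmorphM, rmorph1, rmorph0) /=; ring.
  by rewrite !(rmorphB, rmorphN, rmorphM, rmorph1, rmorph0) /=; ring.
rewrite !mul0r !mulr0 !add0r addr0.
by do 2 (case: leqP => _); rewrite ?(lin0 bS.1) ?inner0l ?inner0r
  ?(shift_inner onb wS) ?(basis_inner onb) ?(negbTE ij) ?mul0r ?mulr0 ?addr0.
Qed.

(** Descent on [k] with the defect [eta x := 4 M ^+ 2 - |A x + B x| ^+ 2]. A small
    defect forces [|A x|] to be close to [M] and, by the parallelogram law,
    [A x] to be close to [B x]. If [Q k.+1 x] is small, so is [Q k.+1 (B x)],
    because [B] acts on another factor and commutes with [Q k.+1]; hence so is
    [Q k.+1 (A x)], and by the previous lemma so is [Q k x]. From [k = K] one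
    comes down to [Q 0 x = x], and a small [x] contradicts [|A x|] close to [M].
    All the bounds are multiples of the defect, so the defect itself is bounded
    below uniformly in [x]. *)
Lemma shift_sum_gap : exists2 c : R, c < M &
  forall x, rnorm x <= 1 -> rnorm (A x + B x) <= 2 * c.
Proof.
have bQ j := tail_bounded onb j.
have Mp : 0 < M by exact: le_lt_trans muM.
pose eta x := 4 * M ^+ 2 - rnorm (A x + B x) ^+ 2.
have ALe x : rnorm (A x) <= M * rnorm x.
  by apply: slot_le => //; exact: (shift_le onb wS).
have BLe x : rnorm (B x) <= M * rnorm x.
  by apply: slot_le => //; exact: (shift_le onb wS).
have par x : rnorm (A x - B x) ^+ 2 + rnorm (A x + B x) ^+ 2 =
    2 * rnorm (A x) ^+ 2 + 2 * rnorm (B x) ^+ 2.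
  by rewrite rnorm_sqrB rnorm_sqrD; ring.
have Asq x : rnorm x <= 1 -> rnorm (A x) ^+ 2 <= M ^+ 2.
  move=> x1; rewrite ler_pXn2r ?nnegrE ?rnorm_ge0 //.
  by rewrite (le_trans (ALe x)) // ler_piMr.
have Bsq x : rnorm x <= 1 -> rnorm (B x) ^+ 2 <= M ^+ 2.
  move=> x1; rewrite ler_pXn2r ?nnegrE ?rnorm_ge0 //.
  by rewrite (le_trans (BLe x)) // ler_piMr.
have eta0 x : rnorm x <= 1 -> 0 <= eta x.
  move=> x1; have := Asq x x1; have := Bsq x x1; have := par x; rewrite /eta.
  have := sqr_ge0 (rnorm (A x - B x)); lra.
have defect x : rnorm x <= 1 ->
    M ^+ 2 * rnorm x ^+ 2 - rnorm (A x) ^+ 2 <= eta x.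
  move=> x1; have := Asq x x1; have := Bsq x x1; have := par x; rewrite /eta.
  have : M ^+ 2 * rnorm x ^+ 2 <= M ^+ 2.
    by rewrite ler_piMr ?sqr_ge0 // expr_le1 ?rnorm_ge0.
  have := sqr_ge0 (rnorm (A x - B x)); lra.
pose claim k := exists2 C : R, 0 <= C &
  forall x, rnorm x <= 1 -> rnorm (Q k x) ^+ 2 <= C * eta x.
have base : claim K.
  have d0 : 0 < M ^+ 2 - mu ^+ 2.
    by rewrite subr_sqr mulr_gt0 ?subr_gt0 // ltr_wpDr.
  exists (M ^+ 2 - mu ^+ 2)^-1 => [|x x1]; first by rewrite invr_ge0 ltW.
  rewrite mulrC ler_pdivlMr // mulrC.
  exact: (le_trans (shift_tail_start x) (defect x x1)).
have step k : claim k.+1 -> claim k.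
  move=> [C C0 hC]; exists ((3 + 2 * M ^+ 2 * C) / M ^+ 2) => [|x x1].
    by rewrite divr_ge0 ?sqr_ge0 // addr_ge0 // !mulr_ge0 // sqr_ge0.
  rewrite mulrAC ler_pdivlMr ?exprn_gt0 // mulrC.
  apply: (le_trans (shift_tail_step k x)).
  have QA : rnorm (Q k.+1 (A x)) <= rnorm (A x - B x) + M * rnorm (Q k.+1 x).
    have -> : Q k.+1 (A x) = Q k.+1 (A x - B x) + Q k.+1 (B x).
      rewrite -[LHS]/(Q k.+1 (A x)) -{1}[A x](subrK (B x)).
      exact: (linD (tens_op_bounded tensP (at_slot_bounded k1 (bQ k.+1))).1).
    apply: (le_trans (rnormD _ _)); rewrite lerD //.
      rewrite -[leRHS]mul1r.
      by apply: slot_le => // h; rewrite mul1r; exact: tail_le.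
    rewrite -[X in rnorm X]/((Q k.+1 \o B) x) (slot_commute tensP) //.
    exact: BLe.
  have dAB : rnorm (A x - B x) ^+ 2 <= eta x.
    have := Asq x x1; have := Bsq x x1; have := par x; rewrite /eta; lra.
  have := defect x x1; have := hC x x1.
  move: QA dAB; have := rnorm_ge0 (Q k.+1 (A x)).
  move: (rnorm (Q k.+1 (A x))) (rnorm (A x - B x)) (rnorm (Q k.+1 x)).
  move=> a b q a0 ab hb hq hd.
  have h1 : a ^+ 2 <= 2 * b ^+ 2 + 2 * (M * q) ^+ 2.
    have := sqr_ge0 (b - M * q); nra.
  have h2 : (M * q) ^+ 2 <= M ^+ 2 * (C * eta x).
    by rewrite exprMn ler_wpM2l ?sqr_ge0.
  lra.
have {base step} [C C0 hC] : claim 0%N by elim: (K) base => // k IHk /step.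
pose d := M ^+ 2 * C + 1.
have d0 : 1 <= d by rewrite lerDr mulr_ge0 // sqr_ge0.
have etaM x : rnorm x <= 1 -> M ^+ 2 / d <= eta x.
  move=> x1; rewrite ler_pdivrMr; last lra.
  have := hC x x1; rewrite /Q tail0.
  rewrite (tens_op_slot_id tensP) => hx.
  have hA : rnorm (A x) ^+ 2 <= M ^+ 2 * (C * eta x).
    apply: (@le_trans _ _ (M ^+ 2 * rnorm x ^+ 2)).
      by rewrite -exprMn ler_pXn2r ?nnegrE ?mulr_ge0 ?rnorm_ge0.
    by rewrite ler_wpM2l ?sqr_ge0.
  have : M ^+ 2 - rnorm (A x) ^+ 2 <= eta x.
    have := par x; have := Asq x x1; have := Bsq x x1; rewrite /eta.
    have := sqr_ge0 (rnorm (A x - B x)); lra.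
  rewrite /d; lra.
(* The constant makes (2 (M - M / (8 d)))^2 exceed 4 M^2 - M^2 / d. *)
exists (M - M / (8 * d)) => [|x x1].
  by rewrite ltrBlDr ltrDl divr_gt0 //; lra.
have hd : M / (8 * d) <= M / 8.
  by rewrite ler_pM2l // lef_pV2 ?posrE //; lra.
have := etaM x x1; rewrite /eta => h.
rewrite -(@ler_pXn2r _ 2) ?nnegrE ?rnorm_ge0 //; last by lra.
have -> : (2 * (M - M / (8 * d))) ^+ 2 =
    4 * M ^+ 2 - M ^+ 2 / d + M ^+ 2 / (16 * d ^+ 2) by field; lra.
have : 0 <= M ^+ 2 / (16 * d ^+ 2).
  by rewrite divr_ge0 ?sqr_ge0 // mulr_ge0 ?sqr_ge0 ?ler0n.
lra.
Qed.

End Gap.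

Lemma cvg_rnorm_le (R : realType) (W : normedModType R[i]) (u : nat -> W) x
    (c : R) :
  (u @ \oo --> x) -> (forall k, rnorm (u k) <= c) -> rnorm x <= c.
Proof.
move=> /cvg_rnorm ux hc; apply/ler_addgt0Pr => r r0.
have [N /(_ N (leqnn N)) hN] := ux _ r0.
by have := rnormD (x - u N) (u N); rewrite subrK; have := hc N; lra.
Qed.

Lemma cvg_mulC (R : realType) (f g : nat -> R[i]) (a b : R[i]) :
  (fun k => f k : R[i]^o) @ \oo --> (a : R[i]^o) ->
  (fun k => g k : R[i]^o) @ \oo --> (b : R[i]^o) ->
  (fun k => f k * g k : R[i]^o) @ \oo --> (a * b : R[i]^o).
Proof. by move=> fa gb; exact: (cvgM fa gb). Qed.

(** * Symmetric and antisymmetric tensors, treated together *)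

Section Isotypic.
Context {R : realType} {H T : hilbertType R} {n : nat}.
Context {tens : ('I_n -> H) -> T}.
Hypothesis tensP : tensor_power tens.
Variable b : bool.

(** The trivial character for [b = false], the sign character for [b = true]. *)
Definition chi (s : 'S_n) : R[i] := (-1) ^+ (b && s).

Definition isotypic : set T :=
  [set x | forall s, perm_op tens s x = chi s *: x].

Lemma chiM s t : chi (s * t)%g = chi s * chi t.
Proof.
by rewrite /chi; case: b => /=; rewrite ?mulr1 // odd_permM signr_addb.
Qed.

Lemma chi_conj s : (chi s)^*%R = chi s.
Proof. by rewrite /chi rmorphXn rmorphN1. Qed.

Lemma chi_sqr s : chi s * chi s = 1.
Proof. by rewrite /chi -signr_addb addbb. Qed.

(** Up to a scalar, the projection of [v_1 (x) ... (x) v_n] onto the tensors of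
    type [chi]. *)
Definition orbit_sum (v : 'I_n -> H) : T := \sum_s chi s *: tens (v \o s).

Lemma orbit_sum_isotypic v : isotypic (orbit_sum v).
Proof.
move=> s; have [bP hP] := perm_opP tensP s.
rewrite /orbit_sum (lin_comb bP.1) scaler_sumr.
rewrite [RHS](reindex_inj (mulgI s)); apply: eq_bigr => t _.
rewrite hP scalerA chiM mulrA chi_sqr mul1r; congr (_ *: tens _).
by apply/funext => i /=; rewrite permM.
Qed.

Lemma isotypicZ c x : isotypic x -> isotypic (c *: x).
Proof.
move=> hx s; have [[lP _] _] := perm_opP tensP s.
by rewrite (linZ lP) hx scalerA mulrC -scalerA.
Qed.

Lemma isotypic0 : isotypic 0.
Proof.
by move=> s; have [[lP _] _] := perm_opP tensP s; rewrite (lin0 lP) scaler0.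
Qed.

Lemma prod_delta (s t : 'S_n) :
  \prod_i (s i == t i)%:R = (s == t)%:R :> R[i].
Proof.
have [->|st] := eqVneq s t; first by rewrite big1 // => i _; rewrite eqxx.
have [i sti] : exists i, s i != t i.
  apply/existsP; rewrite -negb_forall; apply: contra st => /forallP h.
  by apply/eqP/permP => i; apply/eqP.
by rewrite (bigD1 i) //= (negbTE sti) mul0r.
Qed.

Lemma orbit_sum_rnorm v : (forall i j, inner (v i) (v j) = (i == j)%:R) ->
  rnorm (orbit_sum v) ^+ 2 = n`!%:R.
Proof.
move=> ov; apply: complexI; rewrite -inner_rnorm inner_suml rmorph_nat.
rewrite -card_Sn -sum1_card natr_sum big_mkcond /=; apply: eq_bigr => s _.
rewrite inner_sumr (bigD1 s) //= big1 ?addr0 => [|t ts].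
  rewrite innerZl innerZr (tens_inner tensP) chi_conj mulrA chi_sqr mul1r.
  by rewrite big1 // => i _; rewrite ov eqxx.
rewrite innerZl innerZr (tens_inner tensP).
under eq_bigr do rewrite ov.
by rewrite prod_delta eq_sym (negbTE ts) !mulr0.
Qed.

(** The matrix coefficient of [Sop] at an orbit sum, as a function of the matrix
    coefficients [g j p q = <A_j v_p, v_q>]. It is a polynomial in them, hence
    continuous, so only limits of matrix coefficients on [H] are needed. *)
Definition form_sum (g : 'I_n -> 'I_n -> 'I_n -> R[i]) : R[i] :=
  (n`!%:R)^-1 * \sum_(p : 'S_n) \sum_(s : 'S_n) \sum_(t : 'S_n)
    chi s * chi t * \prod_i g (p i) (s i) (t i).

Lemma inner_Sop (A : 'I_n -> H -> H) v : (forall i, bounded_op (A i)) ->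
  inner (Sop tens A (orbit_sum v)) (orbit_sum v) =
  form_sum (fun j p q => inner (A j (v p)) (v q)).
Proof.
move=> bA; rewrite /Sop innerZl; congr (_ * _).
rewrite inner_suml; apply: eq_bigr => p _.
have bAp i : bounded_op ((A \o p) i) by exact: bA.
rewrite (lin_comb (tens_op_bounded tensP bAp).1) inner_suml.
apply: eq_bigr => s _; rewrite inner_sumr; apply: eq_bigr => t _.
rewrite innerZl innerZr chi_conj mulrA.
by rewrite (tens_op_tens tensP bAp) (tens_inner tensP).
Qed.

Lemma form_sum_diag (a : 'I_n -> R[i]) :
  form_sum (fun j p q => a j * (p == q)%:R) = n`!%:R * \prod_i a i.
Proof.
have n0 : n`!%:R != 0 :> R[i] by rewrite pnatr_eq0 -lt0n fact_gt0.
rewrite /form_sum.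
rewrite [X in _ * X = _](eq_bigr (fun=> n`!%:R * \prod_i a i)) => [|p _].
  rewrite sumr_const card_Sn -[X in _ * X = _]mulr_natl mulKf //.
rewrite -card_Sn -[in RHS]sum1_card natr_sum mulr_suml big_mkcond.
apply: eq_bigr => s _; rewrite mul1r (bigD1 s) //=.
rewrite [X in _ + X]big1 ?addr0 => [|t ts].
  rewrite chi_sqr mul1r [RHS](reindex_inj (@perm_inj _ p)) /=.
  by apply: eq_bigr => i _; rewrite eqxx mulr1.
by rewrite big_split /= prod_delta eq_sym (negbTE ts) !mulr0.
Qed.

Lemma form_sum_cvg (g : nat -> 'I_n -> 'I_n -> 'I_n -> R[i]) g' :
  (forall j p q, (fun k => g k j p q : R[i]^o) @ \oo --> (g' j p q : R[i]^o)) ->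
  (fun k => form_sum (g k) : R[i]^o) @ \oo --> (form_sum g' : R[i]^o).
Proof.
move=> hg; rewrite /form_sum; apply: cvg_mulC; first exact: cvg_cst.
do 3 (apply: (@cvg_big R[i]^o) => [|? _]; first exact: add_continuous).
apply: cvg_mulC; first exact: cvg_cst.
by apply: (@cvg_big R[i]^o) => [|i _]; [exact: mul_continuous|exact: hg].
Qed.

Lemma Sop_le (A : 'I_n -> H -> H) (M : 'I_n -> R) :
  (forall i, linear (A i)) -> (forall i, 0 <= M i) ->
  (forall i h, rnorm (A i h) <= M i * rnorm h) ->
  forall x, rnorm (Sop tens A x) <= (\prod_i M i) * rnorm x.
Proof.
move=> lA M0 hM x; have n0 : 0 < n`!%:R :> R by rewrite ltr0n fact_gt0.
rewrite /Sop rnormZ (_ : rnorm _ = n`!%:R^-1); last first.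
  rewrite -(rmorph_nat (real_complex R)) -fmorphV rnorm_real.
  by rewrite ger0_norm // invr_ge0 ltW.
rewrite mulrC ler_pdivrMr // (le_trans (rnorm_sum _ _ _)) //.
apply: (le_trans (ler_sum _ (G := fun=> (\prod_i M i) * rnorm x) _)).
  move=> p _; have [|||_ _ h] := tens_opP tensP (A := A \o p) (M := M \o p).
  - by move=> i; exact: lA.
  - by move=> i; exact: M0.
  - by move=> i; exact: hM.
  by rewrite [X in _ <= X * _](reindex_inj (@perm_inj _ p)); exact: h.
by rewrite sumr_const card_Sn mulr_natr.
Qed.

(** If the matrix coefficients of the [A j] along orthonormal [n]-tuples tend to
    those of the scalars [a j], then [<Sop x, x>] at the orbit sums [x] tends to
    [n! \prod_j a j], whereas [|x| ^+ 2 = n!] throughout. *)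
Lemma Sop_lower (A : 'I_n -> H -> H) (a : 'I_n -> R[i]) (v : nat -> 'I_n -> H) :
  (forall i, bounded_op (A i)) ->
  (forall k i j, inner (v k i) (v k j) = (i == j)%:R) ->
  (forall j p q, (fun k => inner (A j (v k p)) (v k q) : R[i]^o) @ \oo -->
     (a j * (p == q)%:R : R[i]^o)) ->
  \prod_i rnorm (a i) <= opnorm_on isotypic (Sop tens A).
Proof.
move=> bA ov hA; have [M [M0 hM]] := bounded_opsP bA.
have n0 : 0 < n`!%:R :> R by rewrite ltr0n fact_gt0.
rewrite -rnorm_prod -(ler_pM2l n0).
have -> : n`!%:R * rnorm (\prod_i a i) = rnorm (n`!%:R * \prod_i a i).
  by rewrite rnormM -(rmorph_nat (real_complex R)) rnorm_real ger0_norm // ltW.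
rewrite -form_sum_diag; apply: (cvg_rnorm_le (form_sum_cvg hA)) => k.
rewrite -inner_Sop //; set x := orbit_sum _.
have xn : rnorm x ^+ 2 = n`!%:R by exact: orbit_sum_rnorm.
have x0 : 0 < rnorm x.
  rewrite lt0r rnorm_ge0 andbT; apply/eqP => h.
  by move: n0; rewrite -xn h expr0n ltxx.
apply: (le_trans (cauchy_schwarz _ _)); rewrite -xn expr2 mulrAC ler_pM2r //.
have Sle := Sop_le (fun i => (bA i).1) M0 hM.
have SZ c y : Sop tens A (c *: y) = c *: Sop tens A y.
  rewrite /Sop scalerA mulrC -scalerA; congr (_ *: _); rewrite scaler_sumr.
  apply: eq_bigr => p _; rewrite linZ //.
  by apply: (tens_op_bounded tensP _).1 => i; exact: bA.
have := @le_opnorm_on _ _ isotypic (Sop tens A) (\prod_i M i)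
  ((rnorm x)^-1%:C *: x) (prodr_ge0 _ (fun i _ => M0 i)) Sle.
rewrite SZ [rnorm (_ *: Sop _ _ _)]rnormZ [rnorm (_ *: x)]rnormZ rnorm_real.
rewrite ger0_norm ?invr_ge0 ?rnorm_ge0 // mulVf ?gt_eqF //.
move=> h; rewrite -(ler_pdivrMl _ _ x0); apply: h => //.
by apply: isotypicZ; exact: orbit_sum_isotypic.
Qed.

End Isotypic.

(** * Approximate eigenvectors of the shift *)

Section Eigen.
Context {R : realType} {H : hilbertType R} {e : nat -> H}.
Context {alpha : nat -> R[i]} {S : H -> H} {a : R[i]}.
Hypothesis onb : orthonormal_basis e.
Hypothesis wS : weighted_shift e alpha S.
Hypothesis alpha_a : (alpha : nat -> R[i]^o) @ \oo --> (a : R[i]^o).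

(** Far out the shift is nearly [a] times the unweighted shift, for which a
    normalised sum over a block of [q ^ 2] consecutive basis vectors is moved
    only at its two ends, an error of order [1 / q]. Disjoint blocks make the
    vectors orthonormal, and the block length is taken to be a square so that
    the normalising factor is [1 / q]. *)
Lemma approx_eigenvectors n (r : R) : 0 < r -> exists v : 'I_n -> H,
  (forall i j, inner (v i) (v j) = (i == j)%:R) /\
  (forall i, rnorm (S (v i) - a *: v i) <= r).
Proof.
move=> r0; have r2 : 0 < r / 2 by rewrite divr_gt0.
have /cvg_rnorm/(_ _ r2)[N0 hN0] := alpha_a.
have [q qN0 qr] : exists2 q, (N0 < q)%N & 4 * rnorm a / r <= q%:R.
  exists (maxn N0.+1 (Num.truncn (4 * rnorm a / r)).+1).
    by rewrite leq_maxl.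
  apply: (@le_trans _ _ (Num.truncn (4 * rnorm a / r)).+1%:R).
    by apply/ltW/truncnS_gt.
  by rewrite ler_nat leq_maxr.
have q0 : 0 < q%:R :> R by rewrite ltr0n (leq_trans _ qN0).
pose N := (q * q)%N.
have N_gt0 : (0 < N)%N by rewrite muln_gt0 -(ltr0n R) q0.
pose f (i : 'I_n) (k : 'I_N) := (i.+1 * N + k)%N.
have f_inj i : injective (f i) by move=> j k /addnI; exact: val_inj.
have f_div i k : (f i k %/ N)%N = i.+1.
  by rewrite divnMDl // divn_small ?addn0.
pose v i := \sum_(k < N) (q%:R^-1)%:C *: e (f i k).
have qN : N%:R * (q%:R^-1) ^+ 2 = 1 :> R.
  by rewrite natrM; field; rewrite gt_eqF.
(* Block i starts at i.+1 * N, so that every index used is at least N0. *)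
exists v; split=> [i j|i].
  have [->|ij] := eqVneq i j.
    rewrite inner_rnorm rnorm_comb_basis //.
    rewrite (eq_bigr (fun=> (q%:R^-1) ^+ 2)).
      by rewrite sumr_const card_ord -[_ *+ N]mulr_natl qN.
    by move=> k _; rewrite rnorm_real ger0_norm // invr_ge0 ltW.
  rewrite inner_suml big1 // => k _; rewrite inner_sumr big1 // => k' _.
  rewrite innerZl innerZr (basis_inner onb) (_ : (_ == _) = false) ?mulr0 //.
  apply/eqP => /(congr1 (divn^~ N)); rewrite !f_div => -[/val_inj ijE].
  by rewrite ijE eqxx in ij.
(* The weights differ from a by little; the rest telescopes to the two ends. *)
have -> : S (v i) - a *: v i =
    \sum_(k < N) ((q%:R^-1)%:C * (alpha (f i k) - a)) *: e (f i k).+1 +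
    ((q%:R^-1)%:C * a) *: (e (i.+1 * N + N)%N - e (i.+1 * N)%N).
  have -> : e (i.+1 * N + N)%N - e (i.+1 * N)%N =
      \sum_(k < N) (e (f i k).+1 - e (f i k)).
    rewrite /f -(big_mkord predT
      (fun k => e (i.+1 * N + k).+1 - e (i.+1 * N + k)%N)).
    under eq_bigr do rewrite -addnS.
    by rewrite (telescope_sumr (fun k => e (i.+1 * N + k)%N)) // addn0.
  rewrite /v (lin_comb (shift_bounded wS).1) !scaler_sumr -sumrB -big_split.
  apply: eq_bigr => k _ /=; rewrite (shift_basis wS) !scalerA scalerBr.
  rewrite mulrBr scalerBl addrA subrK; congr (_ - _ *: _).
  by rewrite mulrC.
apply: (le_trans (rnormD _ _)).
have h1 : rnorm (\sum_(k < N)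
    ((q%:R^-1)%:C * (alpha (f i k) - a)) *: e (f i k).+1) <= r / 2.
  rewrite -(@ler_pXn2r _ 2) ?nnegrE ?rnorm_ge0 ?(ltW r2) //.
  rewrite (@rnorm_comb_basis _ _ _ onb _ _ (fun k => (f i k).+1)); last first.
    by move=> j k [] /f_inj.
  apply: (@le_trans _ _ (\sum_(k < N) (q%:R^-1) ^+ 2 * (r / 2) ^+ 2)).
    apply: ler_sum => k _.
    rewrite rnormM rnorm_real ger0_norm ?invr_ge0 ?(ltW q0) //.
    rewrite exprMn ler_wpM2l ?sqr_ge0 //.
    rewrite ler_pXn2r ?nnegrE ?rnorm_ge0 ?(ltW r2) //.
    rewrite rdistC; apply/ltW/hN0.
    rewrite /f /N; apply: (leq_trans (ltnW qN0)).
    apply: (@leq_trans (i.+1 * (q * q))%N); last exact: leq_addr.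
    by rewrite mulnA leq_pmull // muln_gt0 /= -(ltr0n R) q0.
  by rewrite sumr_const card_ord -[_ *+ N]mulr_natl mulrA qN mul1r.
have h2 : rnorm (((q%:R^-1)%:C * a) *: (e (i.+1 * N + N)%N - e (i.+1 * N)%N))
    <= r / 2.
  rewrite rnormZ rnormM rnorm_real ger0_norm ?invr_ge0 ?(ltW q0) //.
  apply: (@le_trans _ _ (q%:R^-1 * rnorm a * 2)).
    apply: ler_wpM2l; first by rewrite mulr_ge0 ?rnorm_ge0 ?invr_ge0 ?(ltW q0).
    by apply: (le_trans (rnormD _ _)); rewrite rnormN !(basis_rnorm onb).
  rewrite -mulrA ler_pdivrMl //.
  move: qr; rewrite ler_pdivrMr //; lra.
lra.
Qed.

Lemma iter_eigen (M : R) l : 0 <= M -> (forall h, rnorm (S h) <= M * rnorm h) ->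
  exists2 C : R, 0 <= C & forall (v : H),
    rnorm (iter l S v - a ^+ l *: v) <= C * rnorm (S v - a *: v).
Proof.
have lS := (shift_bounded wS).1.
move=> M0 hM; elim: l => [|l [C C0 IHl]].
  by exists 0 => // v; rewrite expr0 scale1r subrr rnorm0 mul0r.
exists (M * C + rnorm a ^+ l) => [|v].
  by rewrite addr_ge0 ?exprn_ge0 ?rnorm_ge0 // mulr_ge0.
have -> : iter l.+1 S v - a ^+ l.+1 *: v =
    S (iter l S v - a ^+ l *: v) + a ^+ l *: (S v - a *: v).
  by rewrite iterS (linB lS) (linZ lS) scalerBr addrA subrK scalerA exprSr.
rewrite (le_trans (rnormD _ _)) // mulrDl rnormZ rnormX lerD //.
by rewrite (le_trans (hM _)) // -mulrA ler_wpM2l.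
Qed.

Lemma eigen_seq n : exists v : nat -> 'I_n -> H,
  (forall k i j, inner (v k i) (v k j) = (i == j)%:R) /\
  forall l p q, (fun k => inner (iter l S (v k p)) (v k q) : R[i]^o) @ \oo -->
     (a ^+ l * (p == q)%:R : R[i]^o).
Proof.
have [_ [M M0 hM]] := (bounded_opP S).1 (shift_bounded wS).
have /choice[v hv] : forall k : nat, exists v : 'I_n -> H,
    (forall i j, inner (v i) (v j) = (i == j)%:R) /\
    (forall i, rnorm (S (v i) - a *: v i) <= k.+1%:R^-1).
  by move=> k; apply: approx_eigenvectors; rewrite invr_gt0.
exists v; split=> [k|l p q]; first exact: (hv k).1.
have [C C0 hC] := iter_eigen l M0 hM.
apply/cvg_rnorm => r r0.
have rC : 0 < r / (C + 1) by rewrite divr_gt0 // ltr_wpDl.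
have /cvgrPdist_lt/(_ _ rC)[N _ hN] := @cvg_harmonic R.
exists N => k /hN; rewrite /= sub0r normrN ger0_norm // => hk.
have [ov ev] := hv k.
rewrite -ov -innerZl rdistC -innerBl.
apply: (le_lt_trans (cauchy_schwarz _ _)).
rewrite (_ : rnorm (v k q) = 1) ?mulr1; last first.
  by apply: unit_rnorm; rewrite ov eqxx.
apply: (le_lt_trans (hC _)).
move: hk; rewrite ltr_pdivlMr ?ltr_wpDl // => hk.
apply: le_lt_trans hk; rewrite mulrC ler_pM ?rnorm_ge0 ?ev //.
by rewrite lerDl.
Qed.

End Eigen.

(** * Norms for a regular weight *)

Section Regular.
Context {R : realType} {H : hilbertType R} {e : nat -> H}.
Context {alpha : nat -> R[i]} {S : H -> H} {a : R[i]}.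
Hypothesis onb : orthonormal_basis e.
Hypothesis wS : weighted_shift e alpha S.
Hypothesis alpha_a : (alpha : nat -> R[i]^o) @ \oo --> (a : R[i]^o).

Lemma lim_rnorm : limn (fun i => rnorm (alpha i)) = rnorm a.
Proof.
apply: cvg_lim => //.
exact: (cvg_comp _ _ alpha_a (@rnorm_continuous _ (R[i]^o) a)).
Qed.

Let bS := shift_bounded wS.
Let bSa := (adjointP onb wS).1.

Lemma shift_powers_bounded n (l : 'I_n -> nat) k i :
  bounded_op (shift_powers S k l i).
Proof. by rewrite /shift_powers; case: ifP => _; exact: bounded_iter. Qed.

Lemma iter_le (A : H -> H) (M : R) l : 0 <= M ->
  (forall h, rnorm (A h) <= M * rnorm h) ->
  forall h, rnorm (iter l A h) <= M ^+ l * rnorm h.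
Proof.
move=> M0 hM h; elim: l => [|l IHl]; first by rewrite expr0 mul1r.
by rewrite iterS exprS -mulrA (le_trans (hM _)) // ler_wpM2l.
Qed.

Hypothesis regular : forall m, rnorm (alpha m) <= rnorm a.

Lemma regular_opnorm l : opnorm (iter l S) = rnorm a ^+ l.
Proof.
have Sle := iter_le l (rnorm_ge0 a) (shift_le onb wS (rnorm_ge0 a) regular).
apply/eqP; rewrite eq_le; apply/andP; split.
  apply: opnorm_on_le => // x _ x1.
  by rewrite (le_trans (Sle x)) // ler_piMr // exprn_ge0 // rnorm_ge0.
have [v [ov hv]] := eigen_seq onb wS alpha_a 1.
have := hv l ord0 ord0; rewrite eqxx mulr1 -rnormX => cv.
apply: (cvg_rnorm_le cv) => k.
have vk : rnorm (v k ord0) = 1 by apply: unit_rnorm; rewrite ov eqxx.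
apply: (le_trans (cauchy_schwarz _ _)); rewrite vk mulr1.
by apply: (le_opnorm_on _ Sle); rewrite ?exprn_ge0 ?rnorm_ge0 ?vk.
Qed.

(** The vectors of [eigen_seq] are approximate eigenvectors of the shift only,
    but matrix coefficients of the adjoint are conjugates of those of the
    shift, so they converge too, to the conjugate scalars. *)
Lemma regular_isotypic_norm (T : hilbertType R) n (tens : ('I_n -> H) -> T)
    (b : bool) (l : 'I_n -> nat) k : tensor_power tens ->
  opnorm_on (isotypic (tens := tens) b) (Sop tens (shift_powers S k l)) =
  rnorm a ^+ (\sum_i l i).
Proof.
move=> tensP; rewrite expr_sum.
have Sle := shift_le onb wS (rnorm_ge0 a) regular.
have Ale i h : rnorm (shift_powers S k l i h) <= rnorm a ^+ l i * rnorm h.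
  rewrite /shift_powers; case: ifP => _; apply: iter_le; rewrite ?rnorm_ge0 //.
  exact: (adjoint_le onb wS (rnorm_ge0 a) Sle).
have M0 i : 0 <= rnorm a ^+ l i by rewrite exprn_ge0 ?rnorm_ge0.
have bA := shift_powers_bounded l k.
apply/eqP; rewrite eq_le; apply/andP; split.
  apply: opnorm_on_le; first exact: isotypic0.
  move=> x _ x1; apply: (le_trans (Sop_le tensP (fun i => (bA i).1) M0 Ale x)).
  by rewrite ler_piMr // prodr_ge0.
have [v [ov hv]] := eigen_seq onb wS alpha_a n.
pose c (i : 'I_n) := if (i < k)%N then a ^+ l i else (a ^+ l i)^*%R.
rewrite (eq_bigr (fun i => rnorm (c i))) => [|i _]; last first.
  by rewrite /c; case: ifP => _; rewrite ?rnorm_conj rnormX.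
apply: (Sop_lower tensP b bA ov) => i p q.
rewrite /shift_powers /c; case: ifP => _; first exact: hv.
apply/cvg_rnorm => r r0; have /cvg_rnorm/(_ _ r0)[N hN] := hv (l i) q p.
exists N => m /hN.
rewrite [inner (iter _ (adjoint S) _) _]innerC -(adjoint_iter onb wS).
by rewrite -rnorm_conj rmorphB rmorphM /= rmorph_nat eq_sym.
Qed.

End Regular.

(** * The strict inequality for a weight that is not regular *)

Lemma big_S2 (V : nmodType) (F : 'S_2 -> V) :
  \sum_s F s = F 1%g + F (tperm ord0 ord_max).
Proof.
rewrite (bigD1 1%g) // (bigD1 (tperm ord0 ord_max)) /=; last first.
  by apply/eqP => /permP /(_ ord0); rewrite tpermL perm1.
rewrite big1 ?addr0 // => s /andP[s1 st]; exfalso; move: s1 st.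
have ordE (i : 'I_2) : i = ord0 \/ i = ord_max.
  by case: i => [[|[|//]]] i2; [left|right]; apply: val_inj.
have s01 : s ord0 != s ord_max by rewrite (inj_eq perm_inj).
have [s0|s0] := ordE (s ord0); have [s1|s1] := ordE (s ord_max).
- by rewrite s0 s1 eqxx in s01.
- move=> /eqP h; exfalso; apply: h; apply/permP => i.
  by rewrite perm1; have [->|->] := ordE i.
- move=> _ /eqP h; apply: h; apply/permP => i.
  by have [->|->] := ordE i; rewrite ?tpermL ?tpermR.
- by rewrite s0 s1 eqxx in s01.
Qed.

Section Irregular.
Context {R : realType} {H T : hilbertType R} {e : nat -> H}.
Context {alpha : nat -> R[i]} {S : H -> H} {a : R[i]}.
Context {tens : ('I_2 -> H) -> T}.
Hypothesis onb : orthonormal_basis e.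
Hypothesis wS : weighted_shift e alpha S.
Hypothesis alpha_a : (alpha : nat -> R[i]^o) @ \oo --> (a : R[i]^o).
Hypothesis tensP : tensor_power tens.

Definition first_only (i : 'I_2) : nat := (i == ord0).

Lemma shift_powers_first : shift_powers S 2 first_only = at_slot ord0 S.
Proof.
apply/funext => i; rewrite /shift_powers ltn_ord /first_only /at_slot.
by case: eqP.
Qed.

Lemma Sop_first x :
  Sop tens (shift_powers S 2 first_only) x =
  2^-1 *: (tens_op tens (at_slot ord0 S) x +
           tens_op tens (at_slot ord_max S) x).
Proof.
rewrite /Sop shift_powers_first big_S2.
congr (_ *: (_ + _)); congr (tens_op tens _ x).
- by apply/funext => i /=; rewrite perm1.
- apply/funext => i /=; rewrite /at_slot -[X in _ == X](tpermR ord0 ord_max).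
  by rewrite (inj_eq perm_inj).
Qed.

(** The operator is the average of the shift on the first and on the second
    factor. Its norm falls short of [opnorm S] on the whole tensor square, hence
    on both the symmetric and the antisymmetric tensors. *)
Lemma irregular_isotypic_norm (b : bool) m : rnorm a < rnorm (alpha m) ->
  opnorm_on (isotypic (tens := tens) b)
    (Sop tens (shift_powers S 2 first_only)) <
  \prod_(i < 2) opnorm (iter (first_only i) S).
Proof.
move=> am; have bS := shift_bounded wS.
have [_ [M' M'0 hM']] := (bounded_opP S).1 bS.
have opid : opnorm (id : H -> H) = 1.
  apply/eqP; rewrite eq_le; apply/andP; split.
    by apply: opnorm_on_le => // x _.
  rewrite -(basis_rnorm onb 0%N).
  apply: (@le_opnorm_on _ _ setT id 1) => // [x|]; first by rewrite mul1r.
  by rewrite (basis_rnorm onb).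
rewrite big_ord_recl big_ord1 /= opid mulr1.
set M := opnorm S.
have alphaM i : rnorm (alpha i) <= M.
  rewrite -[rnorm (alpha i)]mulr1 -(basis_rnorm onb i.+1) -rnormZ.
  rewrite -(shift_basis wS).
  by apply: (le_opnorm_on M'0 hM') => //; rewrite (basis_rnorm onb).
have aM : rnorm a < M by exact: lt_le_trans (alphaM m).
have [|K hK] := (cvg_rnorm _ _).1 alpha_a ((M - rnorm a) / 2).
  by rewrite divr_gt0 // subr_gt0.
pose mu := (rnorm a + M) / 2.
have mu0 : 0 <= mu by have := rnorm_ge0 a; rewrite /mu; lra.
have muM : mu < M by rewrite /mu; lra.
have alphamu i : (K <= i)%N -> rnorm (alpha i) <= mu.
  move=> /hK; have := rnormD (alpha i - a) a; rewrite subrK rdistC /mu; lra.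
have [//|c cM hc] := shift_sum_gap onb wS tensP mu0 muM alphaM alphamu
  (k1 := ord0) (k2 := ord_max).
apply: le_lt_trans cM; apply: opnorm_on_le; first exact: isotypic0.
move=> x _ x1; rewrite Sop_first rnormZ -(rmorph_nat (real_complex R)) -fmorphV.
rewrite rnorm_real ger0_norm // ler_pdivrMl //; exact: hc.
Qed.

End Irregular.

(** * The theorem *)

Lemma isotypic_sym (R : realType) (H T : hilbertType R) n
    (tens : ('I_n -> H) -> T) :
  isotypic (tens := tens) false = sym_tensors tens.
Proof. by apply/seteqP; split=> x h s; have := h s; rewrite /chi scale1r. Qed.

Lemma isotypic_antisym (R : realType) (H T : hilbertType R) n
    (tens : ('I_n -> H) -> T) :
  isotypic (tens := tens) true = antisym_tensors tens.
Proof. by []. Qed.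

Theorem theorem1p3 (R : realType) (H : hilbertType R)
    (T : nat -> hilbertType R) (tens : forall n, ('I_n -> H) -> T n)
    (e : nat -> H) (alpha : nat -> R[i]) (S : H -> H) :
  (forall n, tensor_power (tens n)) ->
  orthonormal_basis e ->
  cvgn (alpha : nat -> R[i]^o) ->
  weighted_shift e alpha S ->
  [/\ regular_weight alpha <->
      (forall n (l : 'I_n -> nat) k, (2 <= n)%N -> (k <= n)%N ->
        sym_norm (tens n) (shift_powers S k l) =
        \prod_(i < n) opnorm (iter (l i) S)),
      regular_weight alpha <->
      (forall n (l : 'I_n -> nat) k, (2 <= n)%N -> (k <= n)%N ->
        antisym_norm (tens n) (shift_powers S k l) =
        \prod_(i < n) opnorm (iter (l i) S))
    & regular_weight alpha ->
      let lambda := limn (fun i => rnorm (alpha i)) in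
      forall n (l : 'I_n -> nat) k, (2 <= n)%N -> (k <= n)%N ->
        sym_norm (tens n) (shift_powers S k l) =
          lambda ^+ (\sum_(i < n) l i) /\
        antisym_norm (tens n) (shift_powers S k l) =
          lambda ^+ (\sum_(i < n) l i)].
Proof.
move=> tensP onb /cvg_ex[a alpha_a] wS.
have limE := lim_rnorm alpha_a.
have regP : regular_weight alpha <-> forall m, rnorm (alpha m) <= rnorm a.
  by rewrite /regular_weight limE.
have norms b : regular_weight alpha -> forall n (l : 'I_n -> nat) k,
    opnorm_on (isotypic (tens := tens n) b)
      (Sop (tens n) (shift_powers S k l)) =
    rnorm a ^+ (\sum_(i < n) l i).
  move=> /regP reg n l k; exact: (regular_isotypic_norm onb wS alpha_a reg).
have prods n (l : 'I_n -> nat) : regular_weight alpha ->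
    \prod_(i < n) opnorm (iter (l i) S) = rnorm a ^+ (\sum_(i < n) l i).
  move=> /regP reg; rewrite expr_sum; apply: eq_bigr => i _.
  exact: (regular_opnorm onb wS alpha_a reg).
have irregular b : (forall n (l : 'I_n -> nat) k, (2 <= n)%N -> (k <= n)%N ->
    opnorm_on (isotypic (tens := tens n) b)
      (Sop (tens n) (shift_powers S k l)) =
    \prod_(i < n) opnorm (iter (l i) S)) -> regular_weight alpha.
  move=> h; apply/regP => m; rewrite leNgt; apply/negP => am.
  have := irregular_isotypic_norm onb wS alpha_a (tensP 2) b am.
  by rewrite h // ltxx.
rewrite /sym_norm /antisym_norm; split.
- split=> [reg n l k _ _|h]; last first.
    by apply: (irregular false) => n l k; rewrite isotypic_sym; exact: h.
  by rewrite -isotypic_sym norms // prods.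
- split=> [reg n l k _ _|h]; last exact: (irregular true).
  by rewrite -isotypic_antisym norms // prods.
- move=> reg /=; rewrite limE => n l k _ _.
  by rewrite -isotypic_sym -isotypic_antisym !norms.
Qed.
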